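(* Let $(H,\alpha)$ and $(B,\beta)$ be two Hom-Hopf algebras with bijective antipodes. Then the Hom-Long dimodule category ${}^{B}_{H}\mathbb{L}$ of left-left $(H,B)$-Hom-Long dimodules (with its monoidal structure) is an autonomous category, i.e. every object has both a left dual and a right dual.
   Context: All vector spaces, maps and tensor products are over a fixed field $k$; Sweedler notation $\Delta(c)=c_1\otimes c_2$ is used, and $\rho(m)=m_{(-1)}\otimes m_{(0)}$ for coactions. A Hom-algebra $(A,\mu_A,1_A,\alpha)$: a linear space $A$ with a linear multiplication, $1_A\in A$ and a linear bijection $\alpha:A\to A$ with $\alpha(aa')=\alpha(a)\alpha(a')$, $\alpha(1_A)=1_A$, $\alpha(a)(a'a'')=(aa')\alpha(a'')$, $a1_A=1_Aa=\alpha(a)$. A left $(A,\alpha)$-Hom-module $(M,\cdot,\mu)$: a linear space $M$, linear $\cdot:A\otimes M\to M$, and a linear bijection $\mu:M\to M$ with $\mu(a\cdot m)=\alpha(a)\cdot\mu(m)$, $\alpha(a)\cdot(a'\cdot m)=(aa')\cdot\mu(m)$, $1_A\cdot m=\mu(m)$. Morphisms are linear maps $f$ with $f(a\cdot m)=a\cdot f(m)$ commuting with the structure maps. A Hom-coalgebra $(C,\Delta,\epsilon,\beta)$: linear $\Delta:C\to C\otimes C$, $\epsilon:C\to k$, and a linear bijection $\beta$ with $\Delta(\beta(c))=\beta(c_1)\otimes\beta(c_2)$, $\epsilon\circ\beta=\epsilon$, $\beta(c_1)\otimes c_{21}\otimes c_{22}=c_{11}\otimes c_{12}\otimes\beta(c_2)$,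 $\epsilon(c_1)c_2=c_1\epsilon(c_2)=\beta(c)$. A left $(C,\beta)$-Hom-comodule $(M,\rho,\mu)$: linear $\rho:M\to C\otimes M$ and a linear bijection $\mu$ with $\rho(\mu(m))=\beta(m_{(-1)})\otimes\mu(m_{(0)})$, $\epsilon(m_{(-1)})m_{(0)}=\mu(m)$, $\beta(m_{(-1)})\otimes m_{(0)(-1)}\otimes m_{(0)(0)}=m_{(-1)1}\otimes m_{(-1)2}\otimes\mu(m_{(0)})$. Morphisms are colinear maps commuting with the structure maps. A Hom-bialgebra $(H,\alpha)$: a Hom-algebra and Hom-coalgebra with the same structure map $\alpha$ such that $\Delta(hh')=\Delta(h)\Delta(h')$, $\Delta(1)=1\otimes1$, $\epsilon(hh')=\epsilon(h)\epsilon(h')$, $\epsilon(1)=1$. It is a Hom-Hopf algebra if there is a linear map $S:H\to H$ (antipode) with $S(h_1)h_2=h_1S(h_2)=\epsilon(h)1_H$ and $S\circ\alpha=\alpha\circ S$. A left-left $(H,B)$-Hom-Long dimodule $(M,\cdot,\rho,\mu)$: $(M,\cdot,\mu)$ is a left $(H,\alpha)$-Hom-module and $(M,\rho,\mu)$ is a left $(B,\beta)$-Hom-comodule with $\rho(h\cdot m)=\beta(m_{(-1)})\otimes\alpha(h)\cdot m_{(0)}$. The category ${}^{B}_{H}\mathbb{L}$ has these as objects and, as morphisms, the $H$-linear $B$-colinear maps commuting with structure maps. Monoidal structure on ${}^{B}_{H}\mathbb{L}$: for $(M,\mu),(N,\nu)$, the tensor product is $(M\otimes N,\mu\otimes\nu)$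 with $h\cdot(m\otimes n)=h_1\cdot m\otimes h_2\cdot n$ and $\rho(m\otimes n)=\beta^{-2}(m_{(-1)}n_{(-1)})\otimes m_{(0)}\otimes n_{(0)}$; the unit is $I=(k,\mathrm{id})$ with $h\cdot 1=\epsilon(h)$, $\rho(1)=1_B\otimes1$; for $(U,\mu),(V,\nu),(W,\omega)$ the associator is $a_{U,V,W}((u\otimes v)\otimes w)=\mu^{-1}(u)\otimes(v\otimes\omega(w))$, and the unit constraints are $l_V(\lambda\otimes v)=\lambda\nu(v)$, $r_V(v\otimes\lambda)=\lambda\nu(v)$ for $\lambda\in k$. A left dual of $M$ is an object $M^*$ with morphisms $ev:M^*\otimes M\to I$, $coev:I\to M\otimes M^*$ satisfying the usual duality (zig-zag) identities; a right dual is an object ${}^*M$ with morphisms $M\otimes{}^*M\to I$ and $I\to{}^*M\otimes M$ satisfying the analogous identities.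
   Formalization: The objects are restricted to finite-dimensional dimodules, with finite-dimensional duals: for H = B = k an infinite-dimensional space has no dual, since the zig-zag identity writes every m through the finitely many terms of coev(1). *)

(* Defs.v *)
From HB Require Import structures.
From mathcomp Require Import all_boot all_order all_algebra.
From mathcomp Require Import boolp.

Set Implicit Arguments.
Unset Strict Implicit.
Unset Printing Implicit Defensive.

Import GRing.Theory.

Local Open Scope ring_scope.
Local Open Scope quotient_scope.

Declare Scope tens_scope.
Delimit Scope tens_scope with T.
Local Open Scope tens_scope.

Notation bilin := (bilinear_for *:%R *:%R).

(* Tensor products are needed for infinite-dimensional spaces as well.        *)
(* A list s stands for the formal sum of the u (x) v with (u, v) in s.  Two   *)
(* formal sums are identified when every bilinear map takes the same value on *)
(* them; the universal property is then [tlift_pure], [tlift_linear] and      *)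
(* [tens_ext] below.                                                          *)
Section Tensor.
Variables (k : fieldType) (U V : lmodType k).

Definition tsum (W : lmodType k) (f : U -> V -> W) (s : seq (U * V)) : W :=
  \sum_(x <- s) f x.1 x.2.

Definition tens_rel (s t : seq (U * V)) : bool :=
  `[< forall (W : lmodType k) (f : U -> V -> W), bilin f ->
        tsum f s = tsum f t >].

Lemma tens_rel_refl : reflexive tens_rel.
Proof. by move=> s; apply/asboolP. Qed.

Lemma tens_rel_sym : symmetric tens_rel.
Proof.
by move=> s t; apply/asboolP/asboolP => h W f bf; rewrite h.
Qed.

Lemma tens_rel_trans : transitive tens_rel.
Proof.
move=> t s r /asboolP h1 /asboolP h2; apply/asboolP => W f bf.
by rewrite h1 // h2.
Qed.

Canonical tens_equiv :=
  EquivRel tens_rel tens_rel_refl tens_rel_sym tens_rel_trans.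

Definition tensor := {eq_quot tens_rel}.

HB.instance Definition _ := Choice.on tensor.
HB.instance Definition _ := EqQuotient.on tensor.

Lemma tsum_repr (W : lmodType k) (f : U -> V -> W) s :
  bilin f -> tsum f (repr (\pi_tensor s)) = tsum f s.
Proof.
move=> bf; have : tens_rel (repr (\pi_tensor s)) s.
  by rewrite -[tens_rel _ _](@eqquotE _ _ tensor) reprK.
by move/asboolP; apply.
Qed.

Lemma tens_eqP s t :
  (forall (W : lmodType k) (f : U -> V -> W), bilin f -> tsum f s = tsum f t) ->
  \pi_tensor s = \pi_tensor t.
Proof. by move=> h; apply/eqP; rewrite eqquotE; apply/asboolP. Qed.

Definition topp s : seq (U * V) := [seq (- x.1, x.2) | x <- s].
Definition tscale (a : k) s : seq (U * V) := [seq (a *: x.1, x.2) | x <- s].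

Lemma tsum_cat (W : lmodType k) (f : U -> V -> W) s t :
  tsum f (s ++ t) = tsum f s + tsum f t.
Proof. exact: big_cat. Qed.

Lemma bilinDl (W : lmodType k) (f : U -> V -> W) u u' v :
  bilin f -> f (u + u') v = f u v + f u' v.
Proof. by case=> h _; have := h v 1 u u'; rewrite /= !scale1r. Qed.

Lemma bilinDr (W : lmodType k) (f : U -> V -> W) u v v' :
  bilin f -> f u (v + v') = f u v + f u v'.
Proof. by case=> _ h; have := h u 1 v v'; rewrite /= !scale1r. Qed.

Lemma bilin0l (W : lmodType k) (f : U -> V -> W) v : bilin f -> f 0 v = 0.
Proof. by move=> bf; apply: (@addIr _ (f 0 v)); rewrite -bilinDl // !add0r. Qed.

Lemma bilin0r (W : lmodType k) (f : U -> V -> W) u : bilin f -> f u 0 = 0.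
Proof. by move=> bf; apply: (@addIr _ (f u 0)); rewrite -bilinDr // !add0r. Qed.

Lemma bilinZl (W : lmodType k) (f : U -> V -> W) a u v :
  bilin f -> f (a *: u) v = a *: f u v.
Proof.
by move=> bf; have := bf.1 v a u 0; rewrite /= bilin0l // !addr0.
Qed.

Lemma bilinZr (W : lmodType k) (f : U -> V -> W) a u v :
  bilin f -> f u (a *: v) = a *: f u v.
Proof.
by move=> bf; have := bf.2 u a v 0; rewrite /= bilin0r // !addr0.
Qed.

Lemma tsum_scale (W : lmodType k) (f : U -> V -> W) a s :
  bilin f -> tsum f (tscale a s) = a *: tsum f s.
Proof.
move=> bf; rewrite /tsum big_map scaler_sumr.
by apply: eq_bigr => x _; rewrite bilinZl.
Qed.

Lemma tsum_opp (W : lmodType k) (f : U -> V -> W) s :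
  bilin f -> tsum f (topp s) = - tsum f s.
Proof.
move=> bf; rewrite /tsum big_map -sumrN.
by apply: eq_bigr => x _; rewrite /= -[- x.1]scaleN1r bilinZl // scaleN1r.
Qed.

Definition tens_zero : tensor := \pi_tensor [::].
Definition tens_add (s t : tensor) : tensor := \pi_tensor (repr s ++ repr t).
Definition tens_opp (s : tensor) : tensor := \pi_tensor (topp (repr s)).
Definition tens_scale (a : k) (s : tensor) : tensor := \pi_tensor (tscale a (repr s)).

Local Ltac tens_tac :=
  apply: tens_eqP => W f bf;
  rewrite ?(tsum_cat, tsum_repr, tsum_scale, tsum_opp) //.

Lemma tens_addA : associative tens_add.
Proof. by move=> s t r; tens_tac; rewrite addrA. Qed.
Lemma tens_addC : commutative tens_add.
Proof. by move=> s t; tens_tac; rewrite addrC. Qed.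
Lemma tens_add0 : left_id tens_zero tens_add.
Proof.
move=> s; rewrite -[RHS]reprK; tens_tac.
by rewrite /tsum big_nil add0r.
Qed.
Lemma tens_addN : left_inverse tens_zero tens_opp tens_add.
Proof. by move=> s; tens_tac; rewrite addNr /tsum big_nil. Qed.

HB.instance Definition _ :=
  GRing.isZmodule.Build tensor tens_addA tens_addC tens_add0 tens_addN.

Lemma tens_scaleA a b v : tens_scale a (tens_scale b v) = tens_scale (a * b) v.
Proof. by tens_tac; rewrite scalerA. Qed.
Lemma tens_scale1 : left_id 1 tens_scale.
Proof. by move=> s; rewrite -[RHS]reprK; tens_tac; rewrite scale1r. Qed.
Lemma tens_scaleDr : right_distributive tens_scale +%R.
Proof. by move=> a s t; tens_tac; rewrite scalerDr. Qed.
Lemma tens_scaleDl v : {morph tens_scale^~ v : a b / a + b}.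
Proof. by move=> a b; tens_tac; rewrite scalerDl. Qed.

HB.instance Definition _ := GRing.Zmodule_isLmodule.Build k tensor
  tens_scaleA tens_scale1 tens_scaleDr tens_scaleDl.

Definition tens : lmodType k := tensor.

Definition tpure (u : U) (v : V) : tens := \pi_tensor [:: (u, v)].

(* The value f(t_1, t_2) in Sweedler notation; it depends only on t when f is *)
(* bilinear, which is the case at every use below.                            *)
Definition tlift (W : lmodType k) (f : U -> V -> W) (t : tens) : W :=
  tsum f (repr t).

Lemma tpure_bilin : bilin tpure.
Proof.
have e (s : tens) (a : k) (t : tens) :
    a *: s + t = \pi_tensor (tscale a (repr s) ++ repr t).
  rewrite [LHS]/(tens_add (tens_scale a s) t).
  by apply: tens_eqP => W f bf; rewrite !tsum_cat tsum_repr.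
split=> [v a u u'|u a v v']; rewrite /= e /tpure; tens_tac.
  by rewrite /tsum !big_seq1 /= bilinDl // bilinZl.
by rewrite /tsum !big_seq1 /= bilinDr // bilinZr.
Qed.

Lemma tlift_pure (W : lmodType k) (f : U -> V -> W) u v :
  bilin f -> tlift f (tpure u v) = f u v.
Proof. by move=> bf; rewrite /tlift tsum_repr // /tsum big_seq1. Qed.

Lemma tlift_linear (W : lmodType k) (f : U -> V -> W) :
  bilin f -> linear (tlift f).
Proof.
move=> bf a s t; rewrite /tlift.
rewrite [a *: s + t]/(tens_add (tens_scale a s) t).
by rewrite tsum_repr // tsum_cat tsum_repr // tsum_scale.
Qed.

Lemma tens_ind (P : tens -> Prop) :
  (forall u v, P (tpure u v)) -> (forall s t, P s -> P t -> P (s + t)) ->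
  forall t, P t.
Proof.
move=> Pp PD; elim/quotW; elim=> [|[u v] s IHs].
  suff -> : \pi_tensor [::] = tpure 0 0 by [].
  by rewrite /tpure; tens_tac; rewrite /tsum big_nil big_seq1 /= bilin0l.
suff -> : \pi_tensor ((u, v) :: s) = tpure u v + \pi_tensor s by apply: PD.
rewrite [RHS]/(tens_add _ _) /tpure; tens_tac.
by rewrite /tsum big_cons big_seq1.
Qed.

Lemma tens_ext (W : lmodType k) (f g : tens -> W) :
  linear f -> linear g -> (forall u v, f (tpure u v) = g (tpure u v)) ->
  forall t, f t = g t.
Proof.
move=> lf lg fg; apply: tens_ind => // s t fs ft.
by have := lf 1 s t; have := lg 1 s t; rewrite !scale1r => -> ->; rewrite fs ft.
Qed.

End Tensor.

Notation "u ⊗ v" := (tpure u v) (at level 40, left associativity) : tens_scope.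
Notation "\sw_ ( x , y <- t ) E" := (tlift (fun x y => E) t)
  (at level 41, E at level 41, x name, y name, t at level 50,
   format "\sw_ ( x ,  y  <-  t )  E") : tens_scope.

Section LinearClosure.
Variables (k : fieldType) (U V W X : lmodType k).

Lemma lin_id : linear (fun x : U => x).
Proof. by []. Qed.

Lemma lin_comp (f : {linear V -> W}) (g : U -> V) :
  linear g -> linear (fun x => f (g x)).
Proof. by move=> lg a x y; rewrite lg linearP. Qed.

Lemma lin_bilinl (f : V -> W -> X) (g : U -> V) w :
  bilin f -> linear g -> linear (fun x => f (g x) w).
Proof. by case=> bf _ lg a x y; rewrite lg; apply: (bf w). Qed.

Lemma lin_bilinr (f : V -> W -> X) (g : U -> W) v :
  bilin f -> linear g -> linear (fun x => f v (g x)).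
Proof. by case=> _ bf lg a x y; rewrite lg; apply: (bf v). Qed.

Lemma lin_scalel (g : U -> k^o) (v : V) :
  linear g -> linear (fun x => g x *: v).
Proof. by move=> lg a x y; rewrite lg scalerDl scalerA. Qed.

Lemma lin_scaler (g : U -> V) (c : k) :
  linear g -> linear (fun x => c *: g x).
Proof. by move=> lg a x y; rewrite lg scalerDr !scalerA mulrC. Qed.

Lemma lin_tlift_arg (f : V -> W -> X) (g : U -> tens V W) :
  bilin f -> linear g -> linear (fun x => tlift f (g x)).
Proof. by move=> bf lg a x y; rewrite lg; apply: tlift_linear. Qed.

Lemma lin_tlift_body (F : U -> V -> W -> X) (t : tens V W) :
  (forall v w, linear (fun x => F x v w)) -> linear (fun x => tlift (F x) t).
Proof.
move=> lF a x y; rewrite /tlift /tsum scaler_sumr -big_split /=.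
by apply: eq_bigr => i _; rewrite lF.
Qed.

End LinearClosure.

Record lauto (k : fieldType) (U : lmodType k) := LAuto {
  lauto_fun :> {linear U -> U};
  linv : U -> U;
  lautoK : cancel lauto_fun linv;
  linvK : cancel linv lauto_fun
}.

Lemma linv_linear (k : fieldType) (U : lmodType k) (f : lauto U) :
  linear (linv f).
Proof.
by move=> a x y; apply: (can_inj (lautoK f)); rewrite linearP !linvK.
Qed.

Lemma lin_linv (k : fieldType) (U V : lmodType k) (f : lauto V) (g : U -> V) :
  linear g -> linear (fun x => linv f (g x)).
Proof. by move=> lg a x y; rewrite lg linv_linear. Qed.

Section HomStructures.
Variable k : fieldType.

Record hom_algebra (A : lmodType k) (mul : A -> A -> A) (one : A)
    (al : lauto A) : Prop := HomAlgebra {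
  hmul_bilin : bilin mul;
  hal_mul : forall a b, al (mul a b) = mul (al a) (al b);
  hal_one : al one = one;
  hmulA : forall a b c, mul (al a) (mul b c) = mul (mul a b) (al c);
  hmul1 : forall a, mul a one = al a;
  h1mul : forall a, mul one a = al a
}.

Record hom_module (A : lmodType k) (mul : A -> A -> A) (one : A) (al : lauto A)
    (M : lmodType k) (act : A -> M -> M) (mu : lauto M) : Prop := HomModule {
  hact_bilin : bilin act;
  hmu_act : forall a m, mu (act a m) = act (al a) (mu m);
  hactA : forall a b m, act (al a) (act b m) = act (mul a b) (mu m);
  h1act : forall m, act one m = mu m
}.

Record hom_coalgebra (C : lmodType k) (cop : {linear C -> tens C C})
    (eps : {linear C -> k^o}) (be : lauto C) : Prop := HomCoalgebra {
  hcop_be : forall c, cop (be c) = \sw_(c1, c2 <- cop c) (be c1 ⊗ be c2);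
  heps_be : forall c, eps (be c) = eps c;
  hcopA : forall c,
    \sw_(c1, c2 <- cop c) \sw_(c21, c22 <- cop c2) (be c1 ⊗ (c21 ⊗ c22)) =
    \sw_(c1, c2 <- cop c) \sw_(c11, c12 <- cop c1) (c11 ⊗ (c12 ⊗ be c2));
  heps_l : forall c, \sw_(c1, c2 <- cop c) (eps c1 *: c2) = be c;
  heps_r : forall c, \sw_(c1, c2 <- cop c) (eps c2 *: c1) = be c
}.

Record hom_comodule (C : lmodType k) (cop : {linear C -> tens C C})
    (eps : {linear C -> k^o}) (be : lauto C) (M : lmodType k)
    (rho : {linear M -> tens C M}) (mu : lauto M) : Prop := HomComodule {
  hrho_mu : forall m, rho (mu m) = \sw_(c, m0 <- rho m) (be c ⊗ mu m0);
  heps_rho : forall m, \sw_(c, m0 <- rho m) (eps c *: m0) = mu m;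
  hrhoA : forall m,
    \sw_(c, m0 <- rho m) \sw_(c', m00 <- rho m0) (be c ⊗ (c' ⊗ m00)) =
    \sw_(c, m0 <- rho m) \sw_(c1, c2 <- cop c) (c1 ⊗ (c2 ⊗ mu m0))
}.

Record hom_bialgebra (H : lmodType k) (mul : H -> H -> H) (one : H)
    (cop : {linear H -> tens H H}) (eps : {linear H -> k^o})
    (al : lauto H) : Prop := HomBialgebra {
  hbi_alg : hom_algebra mul one al;
  hbi_coalg : hom_coalgebra cop eps al;
  hcop_mul : forall h g, cop (mul h g) =
    \sw_(h1, h2 <- cop h) \sw_(g1, g2 <- cop g) (mul h1 g1 ⊗ mul h2 g2);
  hcop_one : cop one = one ⊗ one;
  heps_mul : forall h g, eps (mul h g) = (eps h : k) * eps g;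
  heps_one : eps one = 1
}.

Record hom_antipode (H : lmodType k) (mul : H -> H -> H) (one : H)
    (cop : {linear H -> tens H H}) (eps : {linear H -> k^o})
    (al : lauto H) (S : {linear H -> H}) : Prop := HomAntipode {
  hantip_l : forall h, \sw_(h1, h2 <- cop h) mul (S h1) h2 = eps h *: one;
  hantip_r : forall h, \sw_(h1, h2 <- cop h) mul h1 (S h2) = eps h *: one;
  hantip_al : forall h, S (al h) = al (S h)
}.

Record homHopf := HomHopf {
  hcarrier :> lmodType k;
  hmul : hcarrier -> hcarrier -> hcarrier;
  hone : hcarrier;
  hcop : {linear hcarrier -> tens hcarrier hcarrier};
  heps : {linear hcarrier -> k^o};
  hal : lauto hcarrier;
  hantip : {linear hcarrier -> hcarrier};
  hbialgP : hom_bialgebra hmul hone hcop heps hal;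
  hantipP : hom_antipode hmul hone hcop heps hal hantip
}.

End HomStructures.

Arguments hone {k} h.
Arguments hcop {k} h.
Arguments heps {k} h.
Arguments hal {k} h.
Arguments hantip {k} h.
Arguments hmul {k h}.

Record dimod (k : fieldType) (H B : homHopf k) := Dimod {
  dcarrier :> lmodType k;
  dact : H -> dcarrier -> dcarrier;
  drho : {linear dcarrier -> tens B dcarrier};
  dmu : lauto dcarrier;
  dmodP : hom_module hmul (hone H) (hal H) dact dmu;
  dcomodP : hom_comodule (hcop B) (heps B) (hal B) drho dmu;
  dlongP : forall h m,
    drho (dact h m) = \sw_(b, m0 <- drho m) (hal B b ⊗ dact (hal H h) m0)
}.

Arguments dact {k H B} d.
Arguments drho {k H B} d.
Arguments dmu {k H B} d.

Record dhom (k : fieldType) (H B : homHopf k) (M N : dimod H B) := Dhom {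
  dhom_fun :> {linear M -> N};
  dhom_act : forall h m, dhom_fun (dact M h m) = dact N h (dhom_fun m);
  dhom_rho : forall m,
    drho N (dhom_fun m) = \sw_(b, m0 <- drho M m) (b ⊗ dhom_fun m0);
  dhom_mu : forall m, dhom_fun (dmu M m) = dmu N (dhom_fun m)
}.

Ltac swlin :=
  lazymatch goal with
  | |- bilinear_for _ _ (@tpure _ _ _) => exact: tpure_bilin
  | |- bilinear_for _ _ (@hmul _ _) =>
      exact: (hmul_bilin (hbi_alg (hbialgP _)))
  | |- bilinear_for _ _ (@dact _ _ _ _) => exact: (hact_bilin (dmodP _))
  | h : bilinear_for _ _ ?f |- bilinear_for _ _ ?f => exact: h
  | |- bilinear_for _ _ _ => split=> ?; cbv beta; swlin
  | |- forall _, _ => intro; cbv beta; swlin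
  | |- GRing.linear_for _ (GRing.Linear.sort _) => exact: linearP
  | |- GRing.linear_for _ (linv _) => exact: linv_linear
  | |- GRing.linear_for _ (fun x => x) => exact: lin_id
  | |- GRing.linear_for _ (fun x => tlift (@?F x) (@?t x)) =>
      first [ refine (@lin_tlift_body _ _ _ _ _ F _ _)
            | refine (@lin_tlift_arg _ _ _ _ _ _ t _ _) ]; cbv beta; swlin
  | |- GRing.linear_for _ (fun x => GRing.Linear.sort _ (@?g x)) =>
      refine (@lin_comp _ _ _ _ _ g _); swlin
  | |- GRing.linear_for _ (fun x => linv _ (@?g x)) =>
      refine (@lin_linv _ _ _ _ g _); swlin
  | |- GRing.linear_for _ (fun x => (@?g x) *: (@?v x)) =>
      first [ refine (@lin_scalel _ _ _ g _ _)
            | refine (@lin_scaler _ _ _ v _ _) ]; swlin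
  | |- GRing.linear_for _ (fun x => ?f (@?g x) (@?w x)) =>
      first [ refine (@lin_bilinl _ _ _ _ _ f g _ _ _)
            | refine (@lin_bilinr _ _ _ _ _ f w _ _ _) ]; swlin
  | |- GRing.linear_for _ (?f ?v) =>
      refine (snd (_ : bilin f) v); swlin
  end.

(* To prove an identity linear in the tensor t, prove it for pure tensors. *)
Ltac swelim t :=
  lazymatch goal with |- ?L = ?R =>
    let l := eval pattern t in L in
    let r := eval pattern t in R in
    lazymatch l with ?F _ => lazymatch r with ?G _ =>
      refine (@tens_ext _ _ _ _ F G _ _ _ t); cbv beta; [swlin | swlin | ]
    end end
  end.

Ltac swext t := swelim t; intros ? ?.

Ltac swpure := repeat (rewrite tlift_pure; [|by swlin]).

Definition mklin (k : fieldType) (U V : lmodType k) (f : U -> V)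
    (lf : linear f) : {linear U -> V} :=
  HB.pack f (GRing.isLinear.Build k U V *:%R f lf).

Section HopfLemmas.
Variables (k : fieldType) (H : homHopf k).
Implicit Types h g : H.

Lemma linv_mul h g :
  linv (hal H) (hmul h g) = hmul (linv (hal H) h) (linv (hal H) g).
Proof.
apply: (can_inj (lautoK (hal H))).
by rewrite (hal_mul (hbi_alg (hbialgP H))) !linvK.
Qed.

Lemma hcop_al h : hcop H (hal H h) =
  \sw_(h1, h2 <- hcop H h) (hal H h1 ⊗ hal H h2).
Proof. exact: (hcop_be (hbi_coalg (hbialgP H))). Qed.

Lemma linv_cop h : hcop H (linv (hal H) h) =
  \sw_(h1, h2 <- hcop H h) (linv (hal H) h1 ⊗ linv (hal H) h2).
Proof.
rewrite -{2}(linvK (hal H) h) hcop_al.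
move: (hcop H _) => X; swext X; swpure.
by rewrite !lautoK.
Qed.

Lemma linv_eps h : heps H (linv (hal H) h) = heps H h.
Proof.
by rewrite -{2}(linvK (hal H) h) (heps_be (hbi_coalg (hbialgP H))).
Qed.

Lemma linv_one : linv (hal H) (hone H) = hone H.
Proof.
by rewrite -{1}(hal_one (hbi_alg (hbialgP H))) lautoK.
Qed.

End HopfLemmas.

Section TensorMap.
Variables (k : fieldType) (U U' V V' : lmodType k).

Definition tmap_fun (f : {linear U -> U'}) (g : {linear V -> V'})
    (t : tens U V) : tens U' V' := \sw_(u, v <- t) (f u ⊗ g v).

Lemma tmap_linear f g : linear (tmap_fun f g).
Proof. rewrite /tmap_fun; swlin. Qed.

Definition tmap f g : {linear tens U V -> tens U' V'} :=
  mklin (tmap_linear f g).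

Lemma tmapE f g t : tmap f g t = \sw_(u, v <- t) (f u ⊗ g v).
Proof. by []. Qed.

End TensorMap.

Section TensorLauto.
Variables (k : fieldType) (U V : lmodType k) (f : lauto U) (g : lauto V).

Let tinv (t : tens U V) : tens U V := \sw_(u, v <- t) (linv f u ⊗ linv g v).

Lemma tlautoK : cancel (tmap f g) tinv.
Proof.
by move=> t; rewrite tmapE /tinv; swext t; swpure; rewrite !lautoK.
Qed.

Lemma tlinvK : cancel tinv (tmap f g).
Proof.
by move=> t; rewrite tmapE /tinv; swext t; swpure; rewrite !linvK.
Qed.

Definition tlauto : lauto (tens U V) := LAuto tlautoK tlinvK.

Lemma tlautoE t : tlauto t = \sw_(u, v <- t) (f u ⊗ g v).
Proof. by []. Qed.

End TensorLauto.

Section TensorProduct.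
Variables (k : fieldType) (H B : homHopf k) (M N : dimod H B).

Definition tact (h : H) (t : tens M N) : tens M N :=
  \sw_(h1, h2 <- hcop H h) \sw_(m, n <- t) (dact M h1 m ⊗ dact N h2 n).

Definition trho_fun (t : tens M N) : tens B (tens M N) :=
  \sw_(m, n <- t) \sw_(b, m0 <- drho M m) \sw_(c, n0 <- drho N n)
    (linv (hal B) (linv (hal B) (hmul b c)) ⊗ (m0 ⊗ n0)).

Lemma trho_linear : linear trho_fun.
Proof. rewrite /trho_fun; swlin. Qed.

Definition trho : {linear tens M N -> tens B (tens M N)} := mklin trho_linear.

Lemma trhoE t : trho t =
  \sw_(m, n <- t) \sw_(b, m0 <- drho M m) \sw_(c, n0 <- drho N n)
    (linv (hal B) (linv (hal B) (hmul b c)) ⊗ (m0 ⊗ n0)).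
Proof. by []. Qed.

Let mu := tlauto (dmu M) (dmu N).

Lemma tens_modP : hom_module hmul (hone H) (hal H) tact mu.
Proof.
split.
- rewrite /tact; swlin.
- move=> h t; rewrite !tlautoE /tact hcop_al.
  swext (hcop H h); swext t; swpure.
  by rewrite (hmu_act (dmodP M)) (hmu_act (dmodP N)).
- move=> h g t; rewrite !tlautoE /tact hcop_al (hcop_mul (hbialgP H)).
  swext (hcop H h); swext (hcop H g); swext t; swpure.
  by rewrite (hactA (dmodP M)) (hactA (dmodP N)).
- move=> t; rewrite !tlautoE /tact (hcop_one (hbialgP H)).
  swext t; swpure.
  by rewrite (h1act (dmodP M)) (h1act (dmodP N)).
Qed.

Lemma tens_comodP : hom_comodule (hcop B) (heps B) (hal B) trho mu.
Proof.
split.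
- move=> t; rewrite trhoE !tlautoE trhoE.
  swelim t => m n; swpure; rewrite (hrho_mu (dcomodP M)) (hrho_mu (dcomodP N)).
  swext (drho M m); swext (drho N n); swpure; rewrite tlautoE; swpure.
  by rewrite -(hal_mul (hbi_alg (hbialgP B))) !lautoK linvK.
- move=> t; rewrite trhoE !tlautoE; swelim t => m n; swpure.
  rewrite -(heps_rho (dcomodP M)) -(heps_rho (dcomodP N)).
  swext (drho M m); swext (drho N n); swpure.
  rewrite !linv_eps (heps_mul (hbialgP B)).
  by rewrite (bilinZl _ _ _ (tpure_bilin _ _)) (bilinZr _ _ _ (tpure_bilin _ _))
    scalerA.
move=> t; rewrite trhoE; swelim t => m n; swpure.
pose F (X : tens B (tens B M)) (Y : tens B (tens B N)) :
    tens B (tens B (tens M N)) :=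
  \sw_(a, r <- X) \sw_(b, x <- r) \sw_(a', r' <- Y) \sw_(b', y <- r')
  (linv (hal B) (linv (hal B) (hmul a a')) ⊗
    (linv (hal B) (linv (hal B) (hmul b b')) ⊗ (x ⊗ y))).
transitivity (F
  (\sw_(c, m0 <- drho M m) \sw_(c', m00 <- drho M m0) (hal B c ⊗ (c' ⊗ m00)))
  (\sw_(c, m0 <- drho N n) \sw_(c', m00 <- drho N m0) (hal B c ⊗ (c' ⊗ m00)))).
  rewrite /F; swelim (drho M m) => a m1; swelim (drho N n) => b n1.
  swpure; rewrite trhoE; swpure; swext (drho M m1); swext (drho N n1); swpure.
  by rewrite -(hal_mul (hbi_alg (hbialgP B))) !lautoK linvK.
rewrite (hrhoA (dcomodP M)) (hrhoA (dcomodP N)) /F.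
swelim (drho M m) => a m1; swelim (drho N n) => b n1; swpure.
rewrite !linv_cop (hcop_mul (hbialgP B)).
swext (hcop B a); swext (hcop B b); swpure.
by rewrite tlautoE; swpure.
Qed.

Lemma tens_longP h t :
  trho (tact h t) = \sw_(b, m0 <- trho t) (hal B b ⊗ tact (hal H h) m0).
Proof.
rewrite !trhoE /tact hcop_al; swelim (hcop H h) => h1 h2.
swelim t => m n; swpure; rewrite !dlongP.
swext (drho M m); swext (drho N n); swpure.
by rewrite -(hal_mul (hbi_alg (hbialgP B))) !lautoK linvK.
Qed.

Definition tensD : dimod H B := Dimod tens_modP tens_comodP tens_longP.

End TensorProduct.

Section UnitObject.
Variables (k : fieldType) (H B : homHopf k).

Definition idlauto : lauto k^o :=
  @LAuto k k^o idfun idfun (fun _ => erefl) (fun _ => erefl).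

Definition unit_act (h : H) (x : k^o) : k^o := heps H h *: x.

Definition unit_rho_fun (x : k^o) : tens B k^o := hone B ⊗ x.

Lemma unit_rho_linear : linear unit_rho_fun.
Proof. rewrite /unit_rho_fun; swlin. Qed.

Definition unit_rho : {linear k^o -> tens B k^o} := mklin unit_rho_linear.

Lemma unit_rhoE x : unit_rho x = hone B ⊗ x.
Proof. by []. Qed.

Lemma unit_modP : hom_module hmul (hone H) (hal H) unit_act idlauto.
Proof.
split=> [|h x|h g x|x]; rewrite /unit_act /=.
- swlin.
- by rewrite (heps_be (hbi_coalg (hbialgP H))).
- rewrite (heps_be (hbi_coalg (hbialgP H))) (heps_mul (hbialgP H)).
  by rewrite scalerA.
- by rewrite (heps_one (hbialgP H)) scale1r.
Qed.

Lemma unit_comodP : hom_comodule (hcop B) (heps B) (hal B) unit_rho idlauto.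
Proof.
split=> x; rewrite !unit_rhoE; swpure.
- by rewrite (hal_one (hbi_alg (hbialgP B))).
- by rewrite (heps_one (hbialgP B)) scale1r.
- rewrite ?unit_rhoE (hcop_one (hbialgP B)); swpure.
  by rewrite (hal_one (hbi_alg (hbialgP B))).
Qed.

Lemma unit_longP h x : unit_rho (unit_act h x) =
  \sw_(b, x0 <- unit_rho x) (hal B b ⊗ unit_act (hal H h) x0).
Proof.
rewrite !unit_rhoE /unit_act; swpure.
by rewrite (hal_one (hbi_alg (hbialgP B))) (heps_be (hbi_coalg (hbialgP H))).
Qed.

Definition unitD : dimod H B := Dimod unit_modP unit_comodP unit_longP.

End UnitObject.

Arguments unitD {k H B}.

Section Constraints.
Variables (k : fieldType) (H B : homHopf k).
Implicit Types U V W : dimod H B.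

Definition assoc U V W (x : tensD (tensD U V) W) : tensD U (tensD V W) :=
  \sw_(t, w <- x) \sw_(u, v <- t) (linv (dmu U) u ⊗ (v ⊗ dmu W w)).

Definition assoc_inv U V W (x : tensD U (tensD V W)) : tensD (tensD U V) W :=
  \sw_(u, t <- x) \sw_(v, w <- t) ((dmu U u ⊗ v) ⊗ linv (dmu W) w).

(* These unit constraints are linear isomorphisms commuting with the structure *)
(* maps, but h . l(1 (x) v) = l(h . (1 (x) v)) only up to alpha^2; replacing   *)
(* dmu by its inverse in lunit and runit would give morphisms of dimodules.    *)
(* The zig-zag identities below do not depend on this choice, since ev and     *)
(* coev commute with the structure maps.                                       *)
Definition lunit V (x : tensD unitD V) : V := \sw_(c, v <- x) ((c : k^o) *: dmu V v).

Definition lunit_inv V (v : V) : tensD unitD V := (1 : k^o) ⊗ linv (dmu V) v.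

Definition runit V (x : tensD V unitD) : V := \sw_(v, c <- x) ((c : k^o) *: dmu V v).

Definition runit_inv V (v : V) : tensD V unitD := linv (dmu V) v ⊗ (1 : k^o).

Lemma assocK U V W : cancel (@assoc U V W) (@assoc_inv U V W).
Proof.
move=> x; rewrite /assoc /assoc_inv.
swelim x => t w; swpure; swext t; swpure.
by rewrite linvK lautoK.
Qed.

Lemma assoc_invK U V W : cancel (@assoc_inv U V W) (@assoc U V W).
Proof.
move=> x; rewrite /assoc /assoc_inv.
swelim x => u t; swpure; swext t; swpure.
by rewrite linvK lautoK.
Qed.

Lemma lunitK V : cancel (@lunit V) (@lunit_inv V).
Proof.
have lf : linear (fun x => lunit_inv (@lunit V x)).
  by rewrite /lunit /lunit_inv; swlin.
move=> x; rewrite /lunit /lunit_inv in lf *.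
apply: (tens_ext lf (@lin_id _ _)) => c v; rewrite tlift_pure; last by swlin.
have -> : (c : k^o) *: dmu V v = dmu V (c *: v) by rewrite linearZ.
rewrite lautoK.
rewrite (bilinZr _ _ _ (tpure_bilin _ _)) -(bilinZl _ _ _ (tpure_bilin _ _)).
by congr (_ ⊗ _); exact: mulr1.
Qed.

Lemma lunit_invK V : cancel (@lunit_inv V) (@lunit V).
Proof.
by move=> v; rewrite /lunit /lunit_inv; swpure; rewrite scale1r linvK.
Qed.

Lemma runitK V : cancel (@runit V) (@runit_inv V).
Proof.
have lf : linear (fun x => runit_inv (@runit V x)).
  by rewrite /runit /runit_inv; swlin.
move=> x; rewrite /runit /runit_inv in lf *.
apply: (tens_ext lf (@lin_id _ _)) => v c; rewrite tlift_pure; last by swlin.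
have -> : (c : k^o) *: dmu V v = dmu V (c *: v) by rewrite linearZ.
rewrite lautoK.
rewrite (bilinZl _ _ _ (tpure_bilin _ _)) -(bilinZr _ _ _ (tpure_bilin _ _)).
by congr (_ ⊗ _); exact: mulr1.
Qed.

Lemma runit_invK V : cancel (@runit_inv V) (@runit V).
Proof.
by move=> v; rewrite /runit /runit_inv; swpure; rewrite scale1r linvK.
Qed.

End Constraints.

Section Duals.
Variables (k : fieldType) (H B : homHopf k).
Implicit Types M D : dimod H B.

(* D is a left dual of M, equivalently M is a right dual of D. *)
Record exact_pairing D M (ev : dhom (tensD D M) unitD)
    (coev : dhom unitD (tensD M D)) : Prop := ExactPairing {
  zigzag_r : forall m : M,
    runit (tmap idfun ev (assoc (tmap coev idfun (lunit_inv m)))) = m;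
  zigzag_l : forall d : D,
    lunit (tmap ev idfun (assoc_inv (tmap idfun coev (runit_inv d)))) = d
}.

Definition left_dual M D : Prop :=
  exists (ev : dhom (tensD D M) unitD) (coev : dhom unitD (tensD M D)),
    exact_pairing ev coev.

Definition right_dual M D : Prop :=
  exists (ev : dhom (tensD M D) unitD) (coev : dhom unitD (tensD D M)),
    exact_pairing ev coev.

(* C selects the objects of a full subcategory.  An exact pairing writes every *)
(* element of M as a combination of the finitely many left components of       *)
(* coev 1, so only finite-dimensional objects can have duals.                  *)
Definition autonomous (C : dimod H B -> Prop) : Prop :=
  forall M, C M ->
    (exists2 D, C D & left_dual M D) /\ (exists2 D, C D & right_dual M D).

Definition fin_dim (M : dimod H B) : Prop :=
  exists (n : nat) (e : 'I_n -> M),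
    forall m, exists c : 'I_n -> k, m = \sum_(i < n) c i *: e i.

End Duals.

(* Main.v *)
(* A basis of M yields dual bases (e_i), (f_i) for a perfect pairing <,> of M
   with a space D.  Transporting the structure of M through the pairing,
     <h . d, m> = <d, T(alpha^-1 h) . mu^-2 m>,
     d_(-1) <d_(0), m> = beta^-1 (T'(m_(-1))) <d, mu^-2 m_(0)>,
   turns D into a dimodule when T and T' are Hom-bialgebra anti-endomorphisms.
   The pairing and the element sum_i e_i (x) f_i are then H-linear and
   B-colinear for D left of M when (T, T') = (S, S^-1), and for D right of M
   when (T, T') = (S^-1, S).  That S reverses products and coproducts is the
   uniqueness of convolution inverses, applied to S(xy) and S(y)S(x) on the
   Hom-coalgebra H (x) H, and to Delta S and S(x_2) (x) S(x_1) in the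
   Hom-algebra H (x) H. *)

Require Import Defs.
From mathcomp Require Import all_boot all_order all_algebra.
From mathcomp Require Import boolp.

Set Implicit Arguments.
Unset Strict Implicit.
Unset Printing Implicit Defensive.

Import GRing.Theory.

Local Open Scope ring_scope.
Local Open Scope tens_scope.

(** * Uniqueness of convolution inverses in the Hom-setting *)

Section ConvolutionInverse.
Variables (k : fieldType) (C A : lmodType k).
Variables (cop : {linear C -> tens C C}) (eps : {linear C -> k^o}).
Variables (be : lauto C) (mul : A -> A -> A) (one : A) (al : lauto A).
Hypotheses (coC : hom_coalgebra cop eps be) (alA : hom_algebra mul one al).

(* The Hom-version of [f = f * (g * h) = (f * g) * h = h]. *)
Lemma conv_inv_uniq (f g h : {linear C -> A}) :
  (forall c, \sw_(c1, c2 <- cop c) mul (f c1) (g c2) = eps c *: one) ->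
  (forall c, \sw_(c1, c2 <- cop c) mul (g c1) (h c2) = eps c *: one) ->
  f =1 h.
Proof.
move=> fg gh; have bm := hmul_bilin alA.
(* Associativity and the unit law contribute one [al] each, coassociativity and the counit law one
   [be] each. The comparison therefore holds up to squares of both maps, which bijectivity
   removes. *)
have key c : al (al (f (be (be c)))) = al (al (h (be (be c)))).
  pose F (x : tens C (tens C C)) : A :=
    \sw_(a, t <- x) \sw_(b, d <- t) mul (al (f a)) (mul (g b) (h d)).
  transitivity
    (F (\sw_(c1, c2 <- cop c) \sw_(c21, c22 <- cop c2) (be c1 ⊗ (c21 ⊗ c22)))).
    rewrite -(heps_r coC c) /F.
    swelim (cop c) => u v; swpure.
    transitivity (mul (al (f (be u))) (\sw_(a, b <- cop v) mul (g a) (h b))).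
      rewrite gh (bilinZr _ _ _ bm) (hmul1 alA); swpure.
      by rewrite !linearZ.
    by swext (cop v); swpure.
  rewrite (hcopA coC) -(heps_l coC c) /F.
  swelim (cop c) => u v; swpure.
  transitivity (mul (\sw_(a, b <- cop u) mul (f a) (g b)) (al (h (be v)))).
    by swext (cop u); swpure; rewrite (hmulA alA).
  by rewrite fg (bilinZl _ _ _ bm) (h1mul alA) !linearZ.
move=> c.
have /(can_inj (lautoK al))/(can_inj (lautoK al)) := key (linv be (linv be c)).
by rewrite !linvK.
Qed.

End ConvolutionInverse.

(** * The tensor square of a Hom-algebra, target of the convolutions in [antip_cop] *)

Section TensorAlgebra.
Variables (k : fieldType) (A : lmodType k) (mul : A -> A -> A) (one : A).
Variables (al : lauto A).
Hypothesis alA : hom_algebra mul one al.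

Definition tens_mul (s t : tens A A) : tens A A :=
  \sw_(a, b <- s) \sw_(c, d <- t) (mul a c ⊗ mul b d).

Lemma tens_algP : hom_algebra tens_mul (one ⊗ one) (tlauto al al).
Proof.
have bm := hmul_bilin alA; rewrite /tens_mul.
split.
- swlin.
- move=> s t; rewrite !tlautoE; swext s; swext t; swpure.
  by rewrite !(hal_mul alA).
- by rewrite tlautoE; swpure; rewrite !(hal_one alA).
- move=> r s t; rewrite !tlautoE; swext r; swext s; swext t; swpure.
  by rewrite !(hmulA alA).
- by move=> s; rewrite tlautoE; swext s; swpure; rewrite !(hmul1 alA).
- by move=> s; rewrite tlautoE; swext s; swpure; rewrite !(h1mul alA).
Qed.

End TensorAlgebra.

(** * The tensor square of a Hom-coalgebra, source of the convolutions in [antip_mul] *)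

Section TensorCoalgebra.
Variables (k : fieldType) (C : lmodType k) (cop : {linear C -> tens C C}).
Variables (eps : {linear C -> k^o}) (be : lauto C).
Hypothesis coC : hom_coalgebra cop eps be.

Definition tens_cop_fun (t : tens C C) : tens (tens C C) (tens C C) :=
  \sw_(x, y <- t) \sw_(x1, x2 <- cop x) \sw_(y1, y2 <- cop y)
    ((x1 ⊗ y1) ⊗ (x2 ⊗ y2)).

Lemma tens_cop_linear : linear tens_cop_fun.
Proof. rewrite /tens_cop_fun; swlin. Qed.

Definition tens_cop : {linear tens C C -> tens (tens C C) (tens C C)} :=
  mklin tens_cop_linear.

Lemma tens_copE t : tens_cop t =
  \sw_(x, y <- t) \sw_(x1, x2 <- cop x) \sw_(y1, y2 <- cop y)
    ((x1 ⊗ y1) ⊗ (x2 ⊗ y2)).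
Proof. by []. Qed.

Definition tens_eps_fun (t : tens C C) : k^o := \sw_(x, y <- t) (eps x *: eps y).

Lemma tens_eps_linear : linear tens_eps_fun.
Proof. rewrite /tens_eps_fun; swlin. Qed.

Definition tens_eps : {linear tens C C -> k^o} := mklin tens_eps_linear.

Lemma tens_epsE t : tens_eps t = \sw_(x, y <- t) (eps x *: eps y).
Proof. by []. Qed.

Lemma tens_coalgP : hom_coalgebra tens_cop tens_eps (tlauto be be).
Proof.
split.
- move=> t; rewrite tlautoE !tens_copE.
  swelim t => x y; swpure; rewrite !(hcop_be coC).
  swext (cop x); swext (cop y); swpure; rewrite !tlautoE; by swpure.
- move=> t; rewrite tlautoE !tens_epsE; swext t; swpure.
  by rewrite !(heps_be coC).
- move=> t; rewrite !tens_copE; swelim t => x y; swpure.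
  (* [F] interleaves two threefold tensors, so coassociativity on the tensor square follows from
     that at [x] and at [y] separately. *)
  pose F (X Y : tens C (tens C C)) :=
    \sw_(a, r <- X) \sw_(b, c <- r) \sw_(a', r' <- Y) \sw_(b', c' <- r')
      ((a ⊗ a') ⊗ ((b ⊗ b') ⊗ (c ⊗ c'))).
  transitivity (F
    (\sw_(c1, c2 <- cop x) \sw_(c21, c22 <- cop c2) (be c1 ⊗ (c21 ⊗ c22)))
    (\sw_(c1, c2 <- cop y) \sw_(c21, c22 <- cop c2) (be c1 ⊗ (c21 ⊗ c22)))).
    rewrite /F; swelim (cop x) => x1 x2; swelim (cop y) => y1 y2; swpure.
    rewrite tens_copE; swpure; swext (cop x2); swext (cop y2); swpure.
    by rewrite tlautoE; swpure.
  rewrite !(hcopA coC) /F; swelim (cop x) => x1 x2; swelim (cop y) => y1 y2.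
  swpure; rewrite tens_copE; swpure; swext (cop x1); swext (cop y1); swpure.
  by rewrite tlautoE; swpure.
- move=> t; rewrite tens_copE tlautoE; swelim t => x y; swpure.
  rewrite -(heps_l coC x) -(heps_l coC y).
  swext (cop x); swext (cop y); swpure; rewrite tens_epsE; swpure.
  by rewrite (bilinZl _ _ _ (tpure_bilin _ _)) (bilinZr _ _ _ (tpure_bilin _ _))
    scalerA.
- move=> t; rewrite tens_copE tlautoE; swelim t => x y; swpure.
  rewrite -(heps_r coC x) -(heps_r coC y).
  swext (cop x); swext (cop y); swpure; rewrite tens_epsE; swpure.
  by rewrite (bilinZl _ _ _ (tpure_bilin _ _)) (bilinZr _ _ _ (tpure_bilin _ _))
    scalerA.
Qed.

End TensorCoalgebra.

Lemma linvZ (k : fieldType) (U : lmodType k) (f : lauto U) (a : k) x :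
  linv f (a *: x) = a *: linv f x.
Proof. by apply: (can_inj (lautoK f)); rewrite linearZ !linvK. Qed.

(** * The antipode and its inverse as Hom-bialgebra anti-endomorphisms *)

Section Antipode.
Variables (k : fieldType) (H : homHopf k).

Let alH := hbi_alg (hbialgP H).
Let coH := hbi_coalg (hbialgP H).
Let bm : bilin (@hmul k H) := hmul_bilin alH.
Let bt : bilin (@tpure k H H) := tpure_bilin _ _.
Let S := hantip H.
Let al := hal H.

(** Shared by the antipode and its inverse, so that one construction of the dual dimodule covers
    both. *)
Record hom_anti (T : {linear H -> H}) : Prop := HomAnti {
  ha_al : forall h, T (al h) = al (T h);
  ha_one : T (hone H) = hone H;
  ha_mul : forall h g, T (hmul h g) = hmul (T g) (T h);
  ha_eps : forall h, heps H (T h) = heps H h;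
  ha_cop : forall h, hcop H (T h) = \sw_(h1, h2 <- hcop H h) (T h2 ⊗ T h1)
}.

(** Two uses of Hom-associativity bring the middle factors together; the twists around them are what
    associativity leaves behind. *)
Lemma hmul_mid (a b c d : H) :
  hmul (hmul a b) (hmul c d) =
  hmul (al a) (hmul (linv al (hmul b c)) d).
Proof.
rewrite -{1}(linvK al (hmul c d)) -(hmulA alH); congr hmul.
by rewrite !linv_mul -{1}(linvK al b) (hmulA alH) linvK.
Qed.

Lemma antip_one : S (hone H) = hone H.
Proof.
apply: (can_inj (lautoK al)); rewrite -(hmul1 alH) (hal_one alH).
have := hantip_l (hantipP H) (hone H).
by rewrite (hcop_one (hbialgP H)) (heps_one (hbialgP H)) scale1r; swpure.
Qed.

(** Since the counit ignores [al], one may compute at [al h], that is at h_1 eps(h_2). There eps(S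
    h_1) eps(h_2) is the counit of S(h_1) h_2. *)
Lemma antip_eps h : heps H (S h) = heps H h.
Proof.
rewrite -(heps_be coH (S h)) -(hantip_al (hantipP H)) -(heps_r coH h).
have := congr1 (heps H) (hantip_l (hantipP H) h).
rewrite linearZ /= (heps_one (hbialgP H)) => e.
transitivity (heps H h *: (1 : k^o)); last exact: mulr1.
rewrite -e.
swext (hcop H h); swpure; rewrite !linearZ /= (heps_mul (hbialgP H)).
by rewrite mulrC.
Qed.

(** In the convolution of maps from the tensor square to [H], the multiplication has the left-hand
    side as a left inverse and the right-hand side as a right inverse. *)
Lemma antip_mul h g : S (hmul h g) = hmul (S g) (S h).
Proof.
have lf : linear (fun t : tens H H => \sw_(x, y <- t) S (hmul x y)) by swlin.
have lg : linear (fun t : tens H H => \sw_(x, y <- t) hmul x y) by swlin.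
have lh : linear (fun t : tens H H => \sw_(x, y <- t) hmul (S y) (S x)) by swlin.
have := @conv_inv_uniq _ _ _ _ _ _ _ _ _ (tens_coalgP coH) alH
  (mklin lf) (mklin lg) (mklin lh) _ _ (h ⊗ g).
rewrite /= !tlift_pure; [|swlin..]; apply=> t.
- rewrite /tens_cop_fun /tens_eps_fun; swelim t => x y; swpure => /=.
  transitivity (\sw_(a, b <- hcop H (hmul x y)) hmul (S a) b).
    rewrite (hcop_mul (hbialgP H)).
    by swext (hcop H x); swext (hcop H y); swpure.
  by rewrite (hantip_l (hantipP H)) (heps_mul (hbialgP H)).
- rewrite /tens_cop_fun /tens_eps_fun; swelim t => x y; swpure => /=.
  (* [hmul_mid] makes y_1 S(y_2) adjacent in (x_1 y_1)(S(y_2) S(x_2)); it collapses first, and x_1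
     S(x_2) afterwards. *)
  transitivity (\sw_(x1, x2 <- hcop H x)
    hmul (al x1) (hmul (linv al (\sw_(y1, y2 <- hcop H y) hmul y1 (S y2))) (S x2))).
    swelim (hcop H x) => x1 x2; swext (hcop H y); swpure.
    exact: hmul_mid.
  have e2 := hantip_r (hantipP H).
  rewrite e2.
  transitivity (heps H y *: al (\sw_(x1, x2 <- hcop H x) hmul x1 (S x2))).
    swext (hcop H x); swpure.
    rewrite linvZ linv_one (bilinZl _ _ _ bm) (bilinZr _ _ _ bm).
    by rewrite (h1mul alH) (hal_mul alH).
  by rewrite e2 linearZ /= (hal_one alH) !scalerA mulrC.
Qed.

(** In the convolution of maps from [H] to its tensor square, the two sides are a left and a right
    inverse of the comultiplication. *)
Lemma antip_cop h : hcop H (S h) = \sw_(h1, h2 <- hcop H h) (S h2 ⊗ S h1).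
Proof.
have lh : linear (fun x : H => \sw_(h1, h2 <- hcop H x) (S h2 ⊗ S h1)) by swlin.
have lf : linear (fun x : H => hcop H (S x)) by swlin.
apply: (@conv_inv_uniq _ _ _ _ _ _ _ _ _ coH (tens_algP alH)
  (mklin lf) (hcop H) (mklin lh) _ _ h) => x /=.
- have := congr1 (hcop H) (hantip_l (hantipP H) x).
  rewrite linearZ /= (hcop_one (hbialgP H)) => <-; rewrite /tens_mul.
  swext (hcop H x); swpure.
  by rewrite (hcop_mul (hbialgP H)).
- rewrite /tens_mul.
  (* [F] splits the third leg, and [G] multiplies the first leg with the fourth and the second with
     the third. The inverse twists in [G] cancel the [al] of Hom-coassociativity. *)
  pose F (X : tens H (tens H H)) : tens H (tens H (tens H H)) :=
    \sw_(a, r <- X) \sw_(b, c <- r) (a ⊗ (b ⊗ hcop H c)).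
  pose G (X : tens H (tens H (tens H H))) : tens H H :=
    \sw_(a, r <- X) \sw_(b, r' <- r) \sw_(c, d <- r')
      (hmul a (S (linv al d)) ⊗ hmul b (S (linv al c))).
  transitivity (G (F
    (\sw_(c1, c2 <- hcop H x) \sw_(c11, c12 <- hcop H c1) (c11 ⊗ (c12 ⊗ al c2))))).
    rewrite /F /G; swelim (hcop H x) => c d; swpure; swelim (hcop H c) => a b; swpure.
    rewrite hcop_al; swext (hcop H d); swpure.
    by rewrite !lautoK.
  rewrite -(hcopA coH) /F.
  transitivity (\sw_(c1, c2 <- hcop H x) \sw_(c21, c22 <- hcop H c2)
      (hmul (al c1) (S c22) ⊗ (heps H c21 *: hone H))).
    rewrite /G; swelim (hcop H x) => a c; swpure.
    (* A second coassociativity, inside [c], gathers the two middle legs into one coproduct, which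
       the antipode identity collapses to a counit. *)
    pose K (X : tens H (tens H H)) : tens H H :=
      \sw_(b, r <- X) \sw_(c, d <- r)
        (hmul (al a) (S (linv al d)) ⊗ hmul (linv al b) (S (linv al c))).
    transitivity (K
      (\sw_(c1, c2 <- hcop H c) \sw_(c21, c22 <- hcop H c2) (al c1 ⊗ (c21 ⊗ c22)))).
      rewrite /K; swelim (hcop H c) => b d; swpure; swext (hcop H d); swpure.
      by rewrite lautoK.
    rewrite (hcopA coH) /K; swelim (hcop H c) => b d; swpure.
    rewrite -[heps H b]linv_eps -(hantip_r (hantipP H)) linv_cop.
    swext (hcop H b); swpure.
    by rewrite lautoK.
  transitivity (al (\sw_(c1, c2 <- hcop H x) hmul c1 (S c2)) ⊗ hone H).
    swelim (hcop H x) => a c; swpure.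
    rewrite (hal_mul alH) -(hantip_al (hantipP H)) -(heps_l coH c).
    swext (hcop H c); swpure.
    rewrite (bilinZr _ _ _ bt) linearZ (bilinZr _ _ _ bm).
    by rewrite (bilinZl _ _ _ bt).
  rewrite (hantip_r (hantipP H)) linearZ /= (hal_one alH).
  by rewrite (bilinZl _ _ _ bt).
Qed.

Lemma antip_anti : hom_anti S.
Proof.
split.
- exact: hantip_al (hantipP H).
- exact: antip_one.
- exact: antip_mul.
- exact: antip_eps.
- exact: antip_cop.
Qed.

(** The inverse of [S] is an antipode for the opposite multiplication: [S] is injective and reverses
    products, so applying it to each claim gives back a property of [S] itself. *)
Lemma antip_inv : bijective S -> exists T : {linear H -> H},
  [/\ hom_anti T,
      forall h, \sw_(h1, h2 <- hcop H h) hmul (T h2) h1 = heps H h *: hone H &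
      forall h, \sw_(h1, h2 <- hcop H h) hmul h2 (T h1) = heps H h *: hone H].
Proof.
case=> T0 SK TK.
have lT : linear T0 by move=> a x y; apply: (can_inj SK); rewrite linearP !TK.
pose T := mklin lT; have {}SK : cancel S T by []; have {}TK : cancel T S by [].
move: T SK TK => T SK TK {lT}.
exists T; split; [split| |].
- by move=> h; apply: (can_inj SK); rewrite (hantip_al (hantipP H)) !TK.
- by apply: (can_inj SK); rewrite TK antip_one.
- by move=> h g; apply: (can_inj SK); rewrite antip_mul !TK.
- by move=> h; rewrite -{2}(TK h) antip_eps.
- move=> h; rewrite -{2}(TK h) antip_cop.
  by move: (hcop H _) => X; swext X; swpure; rewrite !SK.
- move=> h; apply: (can_inj SK); rewrite linearZ /= antip_one.
  rewrite -(hantip_l (hantipP H)); swext (hcop H h); swpure.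
  by rewrite antip_mul TK.
- move=> h; apply: (can_inj SK); rewrite linearZ /= antip_one.
  rewrite -(hantip_r (hantipP H)); swext (hcop H h); swpure.
  by rewrite antip_mul TK.
Qed.

End Antipode.

(** * Bases and perfect pairings of finite-dimensional spaces *)

Section DualBases.
Variables (k : fieldType) (M : lmodType k).

Lemma spanning_basis n (e : 'I_n -> M) :
  (forall m, exists c : 'I_n -> k, m = \sum_(i < n) c i *: e i) ->
  exists r (b : 'I_r -> M),
    (forall m, exists c : 'I_r -> k, m = \sum_(i < r) c i *: b i) /\
    (forall c : 'I_r -> k, \sum_(i < r) c i *: b i = 0 -> forall i, c i = 0).
Proof.
elim: n e => [|n IHn] e spe; first by exists 0, e; split=> // c _ [].
have [fr|] := pselect (forall c : 'I_n.+1 -> k,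
    \sum_(i < n.+1) c i *: e i = 0 -> forall i, c i = 0).
  by exists n.+1, e.
move=> /existsNP[c /not_implyP[c0 /existsNP[j cj]]].
apply: (IHn (fun i => e (lift j i))) => m.
have [a ->] := spe m.
exists (fun i => a (lift j i) - a j / c j * c (lift j i)).
have ej : e j = - ((c j)^-1 *: \sum_(i < n) c (lift j i) *: e (lift j i)).
  move: c0; rewrite (bigD1_ord j) //= => /eqP; rewrite addr_eq0 => /eqP c0.
  by rewrite -scalerN -c0 scalerA mulVf ?scale1r //; apply/eqP.
rewrite (bigD1_ord j) //= ej scalerN scalerA scaler_sumr -sumrN -big_split /=.
by apply: eq_bigr => i _; rewrite scalerBl scalerA addrC.
Qed.

(** The two expansions express that the pairing [p] is perfect, and spare any later appeal to linear
    independence. *)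
Lemma dual_bases :
  (exists n (e : 'I_n -> M),
    forall m, exists c : 'I_n -> k, m = \sum_(i < n) c i *: e i) ->
  exists (D : lmodType k) (p : D -> M -> k^o) (n : nat)
      (e : 'I_n -> M) (f : 'I_n -> D),
    [/\ bilin p, forall d, d = \sum_(i < n) p d (e i) *: f i &
        forall m, m = \sum_(i < n) p (f i) m *: e i].
Proof.
case=> n0 [e0 /spanning_basis[n [e [spe fre]]]].
have [c cE] := choice spe.
(* Coordinates are unique by [fre], so properties of the chosen [c] are proved by exhibiting
   coefficients. *)
have ceq m (d : 'I_n -> k) : m = \sum_(i < n) d i *: e i -> c m =1 d.
  move=> md i; apply/eqP; rewrite -subr_eq0; apply/eqP.
  apply: (fre (fun i => c m i - d i)).
  under eq_bigr do rewrite scalerBl.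
  by rewrite sumrB -cE -md subrr.
have clin a x y i : c (a *: x + y) i = a * c x i + c y i.
  apply: (ceq _ (fun i => a * c x i + c y i)).
  under eq_bigr do rewrite scalerDl -scalerA.
  by rewrite big_split /= -scaler_sumr -!cE.
have ce i j : c (e i) j = (i == j)%:R.
  apply: (ceq _ (fun j => (i == j)%:R)).
  rewrite (bigD1 i) //= eqxx scale1r big1 ?addr0 // => l.
  by rewrite eq_sym => /negPf ->; rewrite scale0r.
(* A basis identifies the dual space of M with M itself. *)
exists M, (fun x y => \sum_(i < n) c x i * c y i), n, e, e; split.
- split=> [y a x x'|x a y y'] /=; rewrite scaler_sumr -big_split /=;
    apply: eq_bigr => i _; rewrite clin.
    by rewrite mulrDl [a *: _]mulrA.
  by rewrite mulrDr [a *: _]mulrCA.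
- move=> x; rewrite [LHS]cE; apply: eq_bigr => i _; congr (_ *: _).
  rewrite (bigD1 i) //= ce eqxx mulr1 big1 ?addr0 // => l.
  by rewrite ce eq_sym => /negPf ->; rewrite mulr0.
- move=> x; rewrite [LHS]cE; apply: eq_bigr => i _; congr (_ *: _).
  rewrite (bigD1 i) //= ce eqxx mul1r big1 ?addr0 // => l.
  by rewrite ce eq_sym => /negPf ->; rewrite mul0r.
Qed.

End DualBases.

(** * Transposes, contractions and canonical elements of a perfect pairing *)

Section Contraction.
Variables (k : fieldType) (D M : lmodType k) (p : D -> M -> k^o).
Variables (n : nat) (e : 'I_n -> M) (f : 'I_n -> D).
Hypotheses (pB : bilin p) (pD : forall d, d = \sum_(i < n) p d (e i) *: f i).
Hypothesis pM : forall m, m = \sum_(i < n) p (f i) m *: e i.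

Lemma expandl (W : lmodType k) (F : D -> W) d :
  linear F -> F d = \sum_(i < n) p d (e i) *: F (f i).
Proof.
move=> lF; rewrite {1}(pD d) -[F _]/(mklin lF _) linear_sum.
by apply: eq_bigr => i _; rewrite linearZ.
Qed.

Lemma expandr (W : lmodType k) (F : M -> W) m :
  linear F -> F m = \sum_(i < n) p (f i) m *: F (e i).
Proof.
move=> lF; rewrite {1}(pM m) -[F _]/(mklin lF _) linear_sum.
by apply: eq_bigr => i _; rewrite linearZ.
Qed.

Lemma pairing_inj x y : (forall m, p x m = p y m) -> x = y.
Proof. by move=> xy; rewrite (pD x) (pD y); apply: eq_bigr => i _; rewrite xy. Qed.

Definition adjoint (A : M -> M) (d : D) : D := \sum_(i < n) p d (A (e i)) *: f i.

Lemma adjointE A d m : linear A -> p (adjoint A d) m = p d (A m).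
Proof.
move=> lA; have lp : linear (fun x => p x m) by swlin.
have lq : linear (fun x => p d (A x)).
  by move=> a x y; rewrite lA; apply: (pB.2 d a).
rewrite -[p _ m]/(mklin lp _) linear_sum (expandr _ lq).
by apply: eq_bigr => i _; rewrite linearZ /= [LHS]mulrC.
Qed.

Lemma adjoint_linear A : linear (adjoint A).
Proof.
move=> a x y; rewrite scaler_sumr -big_split; apply: eq_bigr => i _ /=.
by have := pB.1 (A (e i)) a x y; rewrite /= => ->; rewrite scalerDl scalerA.
Qed.

(** The canonical map from U ⊗ D to linear maps from M to U; it lets equations between tensors be
    tested on elements of [M]. *)
Definition contract (U : lmodType k) (t : tens U D) (m : M) : U :=
  \sw_(u, d <- t) (p d m *: u).

Lemma contract_bilin (U : lmodType k) : bilin (@contract U).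
Proof. by rewrite /contract; swlin. Qed.

(** A tensor is rebuilt from its contractions at the [e i], by expanding its right leg along [f]. *)
Lemma contract_inj (U : lmodType k) (s t : tens U D) :
  (forall m, contract s m = contract t m) -> s = t.
Proof.
have E (r : tens U D) : r = \sum_(i < n) contract r (e i) ⊗ f i.
  elim/tens_ind: r => [u v|r r' Er Er'].
    rewrite [LHS](expandl v (_ : linear (tpure u))); last by swlin.
    apply: eq_bigr => i _; rewrite /contract; swpure.
    by rewrite (bilinZl _ _ _ (tpure_bilin _ _)).
  rewrite {1}Er {1}Er' -big_split; apply: eq_bigr => i _ /=.
  rewrite -(bilinDl _ _ _ (tpure_bilin _ _)); congr (_ ⊗ _).
  by rewrite (bilinDl _ _ _ (contract_bilin U)).
by move=> st; rewrite (E s) (E t); apply: eq_bigr => i _; rewrite st.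
Qed.

Lemma contract2_inj (U V : lmodType k) (s t : tens U (tens V D)) :
  (forall m, \sw_(u, x <- s) \sw_(v, d <- x) (p d m *: (u ⊗ v)) =
             \sw_(u, x <- t) \sw_(v, d <- x) (p d m *: (u ⊗ v))) -> s = t.
Proof.
pose F (r : tens U (tens V D)) : tens (tens U V) D :=
  \sw_(u, x <- r) \sw_(v, d <- x) ((u ⊗ v) ⊗ d).
pose G (r : tens (tens U V) D) : tens U (tens V D) :=
  \sw_(x, d <- r) \sw_(u, v <- x) (u ⊗ (v ⊗ d)).
have FK r : G (F r) = r.
  by rewrite /F /G; swelim r => u x; swpure; swext x; swpure.
have cF r m : contract (F r) m = \sw_(u, x <- r) \sw_(v, d <- x) (p d m *: (u ⊗ v)).
  by rewrite /contract /F; swelim r => u x; swpure; swext x; swpure.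
move=> st; rewrite -(FK s) -(FK t); congr G; apply: contract_inj => m.
by rewrite !cF.
Qed.

Lemma contractl_inj (U : lmodType k) (s t : tens D U) :
  (forall m, \sw_(d, u <- s) (p d m *: u) = \sw_(d, u <- t) (p d m *: u)) ->
  s = t.
Proof.
pose F (r : tens D U) : tens U D := \sw_(d, u <- r) (u ⊗ d).
pose G (r : tens U D) : tens D U := \sw_(u, d <- r) (d ⊗ u).
have FK r : G (F r) = r by rewrite /F /G; swext r; swpure.
have cF r m : contract (F r) m = \sw_(d, u <- r) (p d m *: u).
  by rewrite /contract /F; swext r; swpure.
move=> st; rewrite -(FK s) -(FK t); congr G; apply: contract_inj => m.
by rewrite !cF.
Qed.

Lemma contract2l_inj (U V : lmodType k) (s t : tens U (tens D V)) :
  (forall m, \sw_(u, x <- s) \sw_(d, v <- x) (p d m *: (u ⊗ v)) =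
             \sw_(u, x <- t) \sw_(d, v <- x) (p d m *: (u ⊗ v))) -> s = t.
Proof.
pose F (r : tens U (tens D V)) : tens D (tens U V) :=
  \sw_(u, x <- r) \sw_(d, v <- x) (d ⊗ (u ⊗ v)).
pose G (r : tens D (tens U V)) : tens U (tens D V) :=
  \sw_(d, x <- r) \sw_(u, v <- x) (u ⊗ (d ⊗ v)).
have FK r : G (F r) = r.
  by rewrite /F /G; swelim r => u x; swpure; swext x; swpure.
have cF r m : \sw_(d, x <- F r) (p d m *: x) =
    \sw_(u, x <- r) \sw_(d, v <- x) (p d m *: (u ⊗ v)).
  by rewrite /F; swelim r => u x; swpure; swext x; swpure.
move=> st; rewrite -(FK s) -(FK t); congr G; apply: contractl_inj => m.
by rewrite !cF.
Qed.

(** The tensor that corresponds to the identity map of [M]. *)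
Definition coevr : tens M D := \sum_(i < n) e i ⊗ f i.

Definition coevl : tens D M := \sum_(i < n) f i ⊗ e i.

Lemma tlift_coevr (W : lmodType k) (F : M -> D -> W) :
  bilin F -> \sw_(m, d <- coevr) F m d = \sum_(i < n) F (e i) (f i).
Proof.
move=> bF; rewrite -[LHS]/(mklin (tlift_linear bF) _) linear_sum.
by apply: eq_bigr => i _ /=; rewrite tlift_pure.
Qed.

Lemma tlift_coevl (W : lmodType k) (F : D -> M -> W) :
  bilin F -> \sw_(d, m <- coevl) F d m = \sum_(i < n) F (f i) (e i).
Proof.
move=> bF; rewrite -[LHS]/(mklin (tlift_linear bF) _) linear_sum.
by apply: eq_bigr => i _ /=; rewrite tlift_pure.
Qed.

(** With [coevrKd], this is the pair of untwisted zig-zag identities. *)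
Lemma coevrK m : \sw_(x, d <- coevr) (p d m *: x) = m.
Proof. by rewrite tlift_coevr //; swlin. Qed.

Lemma coevlK m : \sw_(d, x <- coevl) (p d m *: x) = m.
Proof. by rewrite tlift_coevl //; swlin. Qed.

Lemma coevrKd d : \sw_(x, d' <- coevr) (p d x *: d') = d.
Proof. by rewrite tlift_coevr //; swlin. Qed.

Lemma coevlKd d : \sw_(d', x <- coevl) (p d x *: d') = d.
Proof. by rewrite tlift_coevl //; swlin. Qed.

End Contraction.

(** * Calculation rules for inverse structure maps *)

Section DimodLemmas.
Variables (k : fieldType) (H B : homHopf k) (M : dimod H B).

Lemma linv_act h (m : M) :
  linv (dmu M) (dact M h m) = dact M (linv (hal H) h) (linv (dmu M) m).
Proof.
by apply: (can_inj (lautoK (dmu M))); rewrite (hmu_act (dmodP M)) !linvK.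
Qed.

Lemma act_act a b (m : M) :
  dact M a (dact M b m) = dact M (hmul (linv (hal H) a) b) (dmu M m).
Proof. by rewrite -(hactA (dmodP M)) linvK. Qed.

Lemma linv_rho (m : M) : drho M (linv (dmu M) m) =
  \sw_(b, m0 <- drho M m) (linv (hal B) b ⊗ linv (dmu M) m0).
Proof.
rewrite -{2}(linvK (dmu M) m) (hrho_mu (dcomodP M)).
move: (drho M _) => X; swext X; swpure.
by rewrite !lautoK.
Qed.

Lemma linv_anti (T : {linear H -> H}) h :
  hom_anti T -> T (linv (hal H) h) = linv (hal H) (T h).
Proof.
by move=> aT; apply: (can_inj (lautoK (hal H))); rewrite -(ha_al aT) !linvK.
Qed.

End DimodLemmas.

(** * The dimodule structure transported to [D] *)

Section DualDimod.
Variables (k : fieldType) (H B : homHopf k) (M : dimod H B).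
Variables (D : lmodType k) (p : D -> M -> k^o).
Variables (n : nat) (e : 'I_n -> M) (f : 'I_n -> D).
Hypotheses (pB : bilin p) (pD : forall d, d = \sum_(i < n) p d (e i) *: f i).
Hypothesis pM : forall m, m = \sum_(i < n) p (f i) m *: e i.
Variables (TH : {linear H -> H}) (TB : {linear B -> B}).
Hypotheses (aH : hom_anti TH) (aB : hom_anti TB).

Local Notation ai := (linv (hal H)).
Local Notation bi := (linv (hal B)).
Local Notation i := (linv (dmu M)).

(** The inverse is transposed so that [p] is invariant when both arguments are twisted: the unit
    object has the identity as structure map. *)
Definition dual_mu_fun : {linear D -> D} := mklin (adjoint_linear e f pB i).

Lemma dual_muE d m : p (dual_mu_fun d) m = p d (i m).
Proof. apply: adjointE => //; exact: linv_linear. Qed.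

Lemma dual_muK : cancel dual_mu_fun (adjoint p e f (dmu M)).
Proof.
move=> d; apply: (pairing_inj pD) => m; rewrite adjointE ?dual_muE //; last by swlin.
by rewrite lautoK.
Qed.

Lemma dual_muVK : cancel (adjoint p e f (dmu M)) dual_mu_fun.
Proof.
move=> d; apply: (pairing_inj pD) => m; rewrite dual_muE adjointE //; last by swlin.
by rewrite linvK.
Qed.

Definition dual_mu : lauto D := LAuto dual_muK dual_muVK.

(* The powers of the twisting maps here and in [dual_rho_fun] are those needed  *)
(* for the pairing to be a morphism of dimodules.                              *)
Definition dual_act (h : H) (d : D) : D :=
  adjoint p e f (fun m => dact M (TH (ai h)) (i (i m))) d.

Lemma dual_actE h d m : p (dual_act h d) m = p d (dact M (TH (ai h)) (i (i m))).
Proof. by rewrite adjointE //; swlin. Qed.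

(** Transposition reverses the order of two actions, and [TH] reverses it back. *)
Lemma dual_modP : hom_module hmul (hone H) (hal H) dual_act dual_mu.
Proof.
split.
- split=> [d a x y|h]; last exact: adjoint_linear.
  apply: (pairing_inj pD) => m.
  have l1 : linear (fun d => p d m) by swlin.
  have l2 : linear (fun h => p d (dact M (TH (ai h)) (i (i m)))) by swlin.
  by rewrite l1 !dual_actE l2.
- move=> h d; apply: (pairing_inj pD) => m.
  by rewrite dual_muE !dual_actE dual_muE linv_act -(linv_anti _ aH) lautoK.
- move=> h g d; apply: (pairing_inj pD) => m.
  rewrite !dual_actE dual_muE lautoK !linv_act act_act linvK.
  by rewrite !(linv_anti _ aH) (ha_mul aH) !linv_mul.
- move=> d; apply: (pairing_inj pD) => m.
  rewrite !dual_actE dual_muE  linv_one (ha_one aH) (h1act (dmodP M)).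
  by rewrite linvK.
Qed.

Definition dual_rho_fun (d : D) : tens B D :=
  \sum_(j < n) (\sw_(b, m0 <- drho M (e j)) (p d (i (i m0)) *: bi (TB b))) ⊗ f j.

Lemma dual_rhoE d m : contract p (dual_rho_fun d) m =
  \sw_(b, m0 <- drho M m) (p d (i (i m0)) *: bi (TB b)).
Proof.
have lc : linear (fun t : tens B D => contract p t m) by rewrite /contract; swlin.
have lr : linear (fun m => \sw_(b, m0 <- drho M m) (p d (i (i m0)) *: bi (TB b))).
  by swlin.
rewrite -[LHS]/(mklin lc _) linear_sum [RHS](expandr pM _ lr).
by apply: eq_bigr => j _ /=; rewrite /contract; swpure.
Qed.

Lemma dual_rho_linear : linear dual_rho_fun.
Proof.
move=> a x y; apply: (contract_inj pB pD) => m.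
have lc : linear (fun t : tens B D => contract p t m) by rewrite /contract; swlin.
have lr : linear (fun d => \sw_(b, m0 <- drho M m) (p d (i (i m0)) *: bi (TB b))).
  by swlin.
by rewrite lc !dual_rhoE lr.
Qed.

Definition dual_rho : {linear D -> tens B D} := mklin dual_rho_linear.

Lemma dual_comodP : hom_comodule (hcop B) (heps B) (hal B) dual_rho dual_mu.
Proof.
split.
- move=> d; apply: (contract_inj pB pD) => m; rewrite dual_rhoE.
  transitivity (hal B (contract p (dual_rho d) (i m))).
    rewrite dual_rhoE linv_rho; swext (drho M m); swpure.
    by rewrite (linv_anti _ aB) linearZ /= dual_muE linvK.
  rewrite /contract; swext (dual_rho d); swpure.
  by rewrite linearZ /= dual_muE.
- move=> d; apply: (pairing_inj pD) => m.
  transitivity (heps B (contract p (dual_rho d) m)).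
    rewrite /contract; swext (dual_rho d); swpure.
    rewrite linearZ /= (bilinZl _ _ _ pB).
    exact: mulrC.
  rewrite dual_rhoE dual_muE.
  rewrite -{2}[m](lautoK (dmu M)) -(heps_rho (dcomodP M)).
  swext (drho M m); swpure.
  rewrite !linearZ /= linv_eps (ha_eps aB).
  by rewrite !linvZ (bilinZr _ _ _ pB) [LHS]mulrC.
- move=> d; apply: (contract2_inj pB pD) => m.
  have bc : bilin (@contract _ _ _ p B) by exact: contract_bilin.
  (* The common value of both sides. Contracting the iterated coaction of [D] evaluates its inner
     coaction first, so the outer leg [a] of [M] lands second; [ha_cop] produces the same reversal
     on the other side. *)
  pose F (X : tens B (tens B M)) : tens B B :=
    \sw_(a, r <- X) \sw_(b, x <- r)
      (p d (i (i (i (i x)))) *: (bi (bi (TB b)) ⊗ bi (bi (TB a)))).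
  transitivity (F
    (\sw_(c, m0 <- drho M m) \sw_(c', m00 <- drho M m0) (hal B c ⊗ (c' ⊗ m00)))).
    transitivity (\sw_(c, d0 <- dual_rho d) (hal B c ⊗ contract p (dual_rho d0) m)).
      swelim (dual_rho d) => c d0; swpure.
      rewrite /contract; swext (dual_rho d0); swpure.
      by rewrite (bilinZr _ _ _ (tpure_bilin _ _)).
    transitivity (\sw_(b, m0 <- drho M m)
        (hal B (contract p (dual_rho d) (i (i m0))) ⊗ bi (TB b))).
      transitivity (\sw_(c, d0 <- dual_rho d) \sw_(b, m0 <- drho M m)
          (p d0 (i (i m0)) *: (hal B c ⊗ bi (TB b)))).
        swelim (dual_rho d) => c d0; swpure; rewrite dual_rhoE.
        swext (drho M m); swpure.
        by rewrite (bilinZr _ _ _ (tpure_bilin _ _)).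
      rewrite /contract; swelim (dual_rho d) => c d0; swext (drho M m); swpure.
      by rewrite linearZ /= (bilinZl _ _ _ (tpure_bilin _ _)).
    rewrite /F; swelim (drho M m) => b m0; swpure.
    rewrite dual_rhoE !linv_rho; swext (drho M m0); swpure.
    rewrite linearZ /= linvK (ha_al aB) lautoK !(linv_anti _ aB).
    by rewrite (bilinZl _ _ _ (tpure_bilin _ _)).
  rewrite (hrhoA (dcomodP M)) /F.
  transitivity (hcop B (contract p (dual_rho d) (i m))).
    rewrite dual_rhoE linv_rho; swelim (drho M m) => b m0; swpure.
    rewrite linearZ /= linv_cop (ha_cop aB) linv_cop.
    swext (hcop B b); swpure.
    by rewrite lautoK !(linv_anti _ aB).
  rewrite /contract; swelim (dual_rho d) => c d0; swpure; rewrite linearZ /=.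
  rewrite -dual_muE; move: (hcop B c) => X; swext X; swpure.
  by []. 
Qed.

Lemma dual_longP h d : dual_rho (dual_act h d) =
  \sw_(b, d0 <- dual_rho d) (hal B b ⊗ dual_act (hal H h) d0).
Proof.
have bd : bilin dual_act := hact_bilin dual_modP.
apply: (contract_inj pB pD) => m; rewrite dual_rhoE.
transitivity (hal B (contract p (dual_rho d) (dact M (TH h) (i (i m))))).
  rewrite dual_rhoE dlongP !linv_rho.
  swext (drho M m); swpure.
  rewrite dual_actE linearZ /= !linvK (linv_anti _ aB) !linv_act lautoK.
  by rewrite (linv_anti _ aH).
rewrite /contract; swext (dual_rho d); swpure.
by rewrite linearZ /= dual_actE  lautoK.
Qed.

Definition dual : dimod H B := Dimod dual_modP dual_comodP dual_longP.

End DualDimod.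

(** * Morphisms out of the unit object, given by invariant elements *)

Section InvariantHom.
Variables (k : fieldType) (H B : homHopf k) (X : dimod H B) (x : X).
Hypotheses (x_act : forall h, dact X h x = heps H h *: x).
Hypotheses (x_rho : drho X x = hone B ⊗ x) (x_mu : dmu X x = x).

Definition invariant_fun (c : @unitD k H B) : X := (c : k) *: x.

Lemma invariant_linear : linear invariant_fun.
Proof. by move=> a c d; rewrite /invariant_fun scalerDl scalerA. Qed.

Lemma invariant_act h c :
  invariant_fun (dact unitD h c) = dact X h (invariant_fun c).
Proof.
rewrite /invariant_fun (bilinZr _ _ _ (hact_bilin (dmodP X))) x_act.
by rewrite scalerA mulrC.
Qed.

Lemma invariant_rho c : drho X (invariant_fun c) =
  \sw_(b, y <- drho unitD c) (b ⊗ invariant_fun y).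
Proof.
have lc : linear invariant_fun := invariant_linear.
rewrite [drho unitD c]/= /unit_rho_fun tlift_pure.
  by rewrite linearZ x_rho /= (bilinZr _ _ _ (tpure_bilin _ _)).
by rewrite /invariant_fun; swlin.
Qed.

(** Left transparent because the zig-zag proofs unfold it to multiples of [x]. *)
Definition invariant_hom : dhom unitD X.
Proof.
apply: (@Dhom _ _ _ _ _ (mklin invariant_linear)).
- exact: invariant_act.
- exact: invariant_rho.
- move=> c; transitivity (dmu X ((c : k) *: x)); last by [].
  by rewrite linearZ [dmu X x]x_mu.
Defined.

End InvariantHom.

(** * Evaluation and coevaluation morphisms *)

Section Duality.
Variables (k : fieldType) (H B : homHopf k) (M D : dimod H B).
Variables (p : D -> M -> k^o) (n : nat) (e : 'I_n -> M) (f : 'I_n -> D).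
Hypotheses (pB : bilin p) (pD : forall d, d = \sum_(i < n) p d (e i) *: f i).
Hypothesis pM : forall m, m = \sum_(i < n) p (f i) m *: e i.
Variables (TH : {linear H -> H}) (TB : {linear B -> B}).
Hypotheses (aH : hom_anti TH) (aB : hom_anti TB).

Local Notation ai := (linv (hal H)).
Local Notation bi := (linv (hal B)).
Local Notation i := (linv (dmu M)).

Hypothesis muE : forall d m, p (dmu D d) m = p d (i m).
Hypothesis actE : forall h d m,
  p (dact D h d) m = p d (dact M (TH (ai h)) (i (i m))).
Hypothesis rhoE : forall d m, contract p (drho D d) m =
  \sw_(b, m0 <- drho M m) (p d (i (i m0)) *: bi (TB b)).

Let bt (U V : lmodType k) : bilin (@tpure k U V) := tpure_bilin U V.
Let bB : bilin (@hmul k B) := hmul_bilin (hbi_alg (hbialgP B)).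
Let bA : bilin (dact M) := hact_bilin (dmodP M).

(* [swlin] looks this up in the context. *)
Let bcB : bilin (@contract _ _ _ p B) := contract_bilin pB B.

Let one : @unitD k H B := (1 : k^o).

(** Moving scalars across reduces equations in B ⊗ k to equations in [B]. *)
Let pure_one (b : B) (x : k) : b ⊗ (x : @unitD k H B) = (x *: b) ⊗ one.
Proof.
rewrite (bilinZl _ _ _ (bt _ _)) -(bilinZr _ _ _ (bt _ _)).
by congr (_ ⊗ _); rewrite -[LHS]mulr1.
Qed.

(** Counitality applied to m = mu^-1(mu m); the left-hand side is what remains once an antipode
    identity has been applied. *)
Lemma pairing_counit d m :
  \sw_(c, m0 <- drho M m) (p d (i m0) *: (heps B c *: hone B)) =
  p d m *: hone B.
Proof.
rewrite -{2}[m](lautoK (dmu M)) -(heps_rho (dcomodP M)).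
swext (drho M m); swpure.
by rewrite linvZ (bilinZr _ _ _ pB) !scalerA mulrC.
Qed.

(** * Left duals: [TH] acts as an antipode, [TB] as an inverse antipode *)

Section LeftDual.
Hypothesis TH_l : forall h,
  \sw_(h1, h2 <- hcop H h) hmul (TH h1) h2 = heps H h *: hone H.
Hypothesis TH_r : forall h,
  \sw_(h1, h2 <- hcop H h) hmul h1 (TH h2) = heps H h *: hone H.
Hypothesis TB_l : forall b,
  \sw_(b1, b2 <- hcop B b) hmul (TB b2) b1 = heps B b *: hone B.
Hypothesis TB_r : forall b,
  \sw_(b1, b2 <- hcop B b) hmul b2 (TB b1) = heps B b *: hone B.

Definition evl_fun (t : tensD D M) : @unitD k H B := \sw_(d, m <- t) p d m.

Lemma evl_linear : linear evl_fun.
Proof. by rewrite /evl_fun; swlin. Qed.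

(** Moving h_1 across the pairing places TH(h_1) in front of h_2, and [TH_l] collapses the
    product. *)
Lemma evl_act h t :
  evl_fun (dact (tensD D M) h t) = dact unitD h (evl_fun t).
Proof.
rewrite /= /evl_fun /tact /unit_act; swelim t => d m.
transitivity
  (p d (dact M (ai (ai (\sw_(h1, h2 <- hcop H h) hmul (TH h1) h2))) (i m))).
  swext (hcop H h); swpure.
  by rewrite actE !linv_act act_act linvK (linv_anti _ aH) !linv_mul.
rewrite TH_l !linvZ !linv_one (bilinZl _ _ _ bA) (h1act (dmodP M)) linvK.
by rewrite (bilinZr _ _ _ pB); swpure.
Qed.

Lemma evl_rho t : drho unitD (evl_fun t) =
  \sw_(b, x <- drho (tensD D M) t) (b ⊗ evl_fun x).
Proof.
rewrite /= /unit_rho_fun /evl_fun /trho_fun; swelim t => d m.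
rewrite tlift_pure; last by swlin.
rewrite pure_one.
transitivity
  ((\sw_(c, m0 <- drho M m) bi (bi (hmul (contract p (drho D d) m0) c))) ⊗ one);
  last first.
  rewrite /contract; swpure.
  swelim (drho D d) => b d0; swext (drho M m); swpure.
  by rewrite (bilinZl _ _ _ bB) !linvZ [RHS]pure_one.
congr (_ ⊗ _).
(* By [rhoE] the coaction of [d] becomes a second coaction of [M]. Coassociativity turns the two
   legs into c_1 and c_2, with product TB(c_2) c_1. *)
pose F (X : tens B (tens B M)) : B :=
  \sw_(a, r <- X) \sw_(b, x <- r)
    (p d (i (i x)) *: bi (bi (hmul (bi (TB b)) (bi a)))).
transitivity (F (\sw_(c, m0 <- drho M m) \sw_(c', m00 <- drho M m0)
    (hal B c ⊗ (c' ⊗ m00)))).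
  rewrite (hrhoA (dcomodP M)) /F -pairing_counit.
  swelim (drho M m) => c m0; swpure.
  transitivity (p d (i m0) *:
      bi (bi (bi (\sw_(c1, c2 <- hcop B c) hmul (TB c2) c1)))).
    by rewrite TB_l !linvZ !linv_one.
  by swext (hcop B c); swpure; rewrite lautoK -linv_mul.
rewrite /F; swelim (drho M m) => c m0; swpure; rewrite rhoE.
swext (drho M m0); swpure.
by rewrite lautoK (bilinZl _ _ _ bB) !linvZ.
Qed.

Definition evl : dhom (tensD D M) unitD.
Proof.
apply: (@Dhom _ _ _ _ _ (mklin evl_linear)).
- exact: evl_act.
- exact: evl_rho.
- move=> t; rewrite /= /tmap_fun /evl_fun; swext t; swpure.
  by rewrite muE lautoK.
Defined.

Local Notation w := (coevr e f : tensD M D).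

(** Contraction turns [w] into the identity of [M], and the action of [h] on it into that of h_1
    TH(h_2), up to twists. *)
Lemma coevr_act h : dact (tensD M D) h w = heps H h *: w.
Proof.
apply: (contract_inj pB pD) => m.
rewrite /= /tact.
transitivity
  (dact M (ai (\sw_(h1, h2 <- hcop H h) hmul h1 (TH h2))) (i m)).
  rewrite /contract; swelim (hcop H h) => h1 h2; swpure.
  rewrite linv_mul -(linv_anti _ aH) -[i m](linvK (dmu M)) -act_act.
  rewrite -(coevrK pB pM (dact M (TH (ai h2)) (i (i m)))).
  move: (coevr e f) => X; swext X; swpure.
  by rewrite actE (bilinZr _ _ _ bA).
rewrite TH_r linvZ linv_one (bilinZl _ _ _ bA) (h1act (dmodP M)) linvK.
by rewrite (bilinZl _ _ _ (contract_bilin pB _)) [contract _ _ _](coevrK pB pM).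
Qed.

Lemma coevr_rho : drho (tensD M D) w = hone B ⊗ w.
Proof.
apply: (contract2_inj pB pD) => m.
transitivity (hone B ⊗ m); last first.
  rewrite tlift_pure; last by swlin.
  rewrite -{1}(coevrK pB pM m); move: w => X; swext X; swpure.
  by rewrite (bilinZr _ _ _ (bt _ _)).
rewrite /= /trho_fun.
transitivity (\sw_(x, y <- w) \sw_(b, x0 <- drho M x)
    (bi (bi (hmul b (contract p (drho D y) m))) ⊗ x0)).
  move: w => X; rewrite /contract; swelim X => x y; swpure.
  swelim (drho M x) => b x0; swext (drho D y); swpure.
  by rewrite (bilinZr _ _ _ bB) !linvZ (bilinZl _ _ _ (bt _ _)).
(* [rhoE] trades the coaction on the leg [y] for the one on [m]; summing over [w] then replaces [x]
   by [i (i m0)]. *)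
transitivity (\sw_(c, m0 <- drho M m) \sw_(b, x0 <- drho M (i (i m0)))
    (bi (bi (hmul b (bi (TB c)))) ⊗ x0)).
  transitivity (\sw_(c, m0 <- drho M m)
    \sw_(b, x0 <- drho M (\sw_(x, y <- w) (p y (i (i m0)) *: x)))
      (bi (bi (hmul b (bi (TB c)))) ⊗ x0)).
    move: w => X; swelim X => x y; swpure.
    rewrite rhoE; swelim (drho M m) => c m0; swpure.
    rewrite linearZ /=; swext (drho M x); swpure.
    rewrite -[p y _ *: (_ ⊗ v)](bilinZl _ _ _ (bt _ _)); swpure.
    by rewrite (bilinZr _ _ _ bB) (bilinZl _ _ _ bB).
  by congr tlift; apply/funext => c; apply/funext => m0; rewrite coevrK.
(* The inner leg is multiplied on the left, so coassociativity leads to c_2 TB(c_1), as in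
   [TB_r]. *)
pose F (X : tens B (tens B M)) : tens B M :=
  \sw_(a, r <- X) \sw_(b, x <- r)
    (bi (bi (hmul (bi (bi b)) (bi (TB (bi a))))) ⊗ i (i x)).
transitivity (F (\sw_(c, m0 <- drho M m) \sw_(c', m00 <- drho M m0)
    (hal B c ⊗ (c' ⊗ m00)))).
  rewrite /F; swelim (drho M m) => c m0; swpure.
  rewrite !linv_rho; swext (drho M m0); swpure.
  by rewrite lautoK.
rewrite (hrhoA (dcomodP M)) /F.
transitivity (\sw_(c, m0 <- drho M m)
   (bi (bi (bi (bi (\sw_(c1, c2 <- hcop B c) hmul c2 (TB c1))))) ⊗ i m0)).
  swelim (drho M m) => c m0; swpure; swext (hcop B c); swpure.
  by rewrite lautoK (linv_anti _ aB) !linv_mul.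
rewrite -{2}[m](lautoK (dmu M)) -(heps_rho (dcomodP M)).
swext (drho M m); swpure; rewrite TB_r !linvZ !linv_one.
by rewrite (bilinZl _ _ _ (bt _ _)) (bilinZr _ _ _ (bt _ _)).
Qed.

(** Under contraction: conjugating the identity of [M] by [dmu M] changes nothing. *)
Lemma coevr_mu : dmu (tensD M D) w = w.
Proof.
apply: (contract_inj pB pD) => m.
transitivity (dmu M (contract p w (i m))).
  rewrite /contract /= /tmap_fun; move: w => X; swext X; swpure.
  by rewrite muE linearZ.
by rewrite [contract _ _ _](coevrK pB pM) [RHS](coevrK pB pM) linvK.
Qed.

Definition coevr_hom := invariant_hom coevr_act coevr_rho coevr_mu.

(** The twists of the associator and of the unit constraints cancel, leaving [coevrK] and
    [coevrKd]. *)
Lemma left_dualP : left_dual M D.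
Proof.
exists evl, coevr_hom; split=> [m|d].
- have -> : tmap coevr_hom idfun (lunit_inv m) = w ⊗ i m.
    rewrite tmapE /lunit_inv; swpure.
    by rewrite /= /invariant_fun scale1r.
  rewrite /assoc tlift_pure; last by swlin.
  rewrite /runit tmapE.
  rewrite -{2}(coevrK pB pM m).
  move: w => X; swext X; swpure.
  rewrite /= /evl_fun; swpure.
  by rewrite !linvK.
- have -> : tmap idfun coevr_hom (runit_inv d) = linv (dmu D) d ⊗ w.
    rewrite tmapE /runit_inv; swpure.
    by rewrite /= /invariant_fun scale1r.
  rewrite /assoc_inv tlift_pure; last by swlin.
  rewrite /lunit tmapE linvK.
  rewrite -{2}(coevrKd pB pD d).
  move: w => X; swext X; swpure.
  rewrite /= /evl_fun; swpure.
  by rewrite !linvK.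
Qed.

End LeftDual.

(** * Right duals: [TH] acts as an inverse antipode, [TB] as an antipode *)

Section RightDual.
Hypothesis TH_l : forall h,
  \sw_(h1, h2 <- hcop H h) hmul (TH h2) h1 = heps H h *: hone H.
Hypothesis TH_r : forall h,
  \sw_(h1, h2 <- hcop H h) hmul h2 (TH h1) = heps H h *: hone H.
Hypothesis TB_l : forall b,
  \sw_(b1, b2 <- hcop B b) hmul (TB b1) b2 = heps B b *: hone B.
Hypothesis TB_r : forall b,
  \sw_(b1, b2 <- hcop B b) hmul b1 (TB b2) = heps B b *: hone B.

Definition evr_fun (t : tensD M D) : @unitD k H B := \sw_(m, d <- t) p d m.

Lemma evr_linear : linear evr_fun.
Proof. by rewrite /evr_fun; swlin. Qed.

(** Now h_2 is the factor acting on [D]; crossing the pairing yields TH(h_2) h_1. *)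
Lemma evr_act h t :
  evr_fun (dact (tensD M D) h t) = dact unitD h (evr_fun t).
Proof.
rewrite /= /evr_fun /tact /unit_act; swelim t => m d.
transitivity
  (p d (dact M (ai (ai (\sw_(h1, h2 <- hcop H h) hmul (TH h2) h1))) (i m))).
  swext (hcop H h); swpure.
  by rewrite actE !linv_act act_act linvK (linv_anti _ aH) !linv_mul.
rewrite TH_l !linvZ !linv_one (bilinZl _ _ _ bA) (h1act (dmodP M)) linvK.
by rewrite (bilinZr _ _ _ pB); swpure.
Qed.

Lemma evr_rho t : drho unitD (evr_fun t) =
  \sw_(b, x <- drho (tensD M D) t) (b ⊗ evr_fun x).
Proof.
rewrite /= /unit_rho_fun /evr_fun /trho_fun; swelim t => m d.
rewrite tlift_pure; last by swlin.
rewrite pure_one.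
transitivity
  ((\sw_(c, m0 <- drho M m) bi (bi (hmul c (contract p (drho D d) m0)))) ⊗ one);
  last first.
  rewrite /contract; swpure.
  swelim (drho D d) => b d0; swext (drho M m); swpure.
  by rewrite (bilinZr _ _ _ bB) !linvZ [RHS]pure_one.
congr (_ ⊗ _).
(* The leg coming from [D] is multiplied on the right here, so coassociativity gives c_1 TB(c_2). *)
pose F (X : tens B (tens B M)) : B :=
  \sw_(a, r <- X) \sw_(b, x <- r)
    (p d (i (i x)) *: bi (bi (hmul (bi a) (bi (TB b))))).
transitivity (F (\sw_(c, m0 <- drho M m) \sw_(c', m00 <- drho M m0)
    (hal B c ⊗ (c' ⊗ m00)))).
  rewrite (hrhoA (dcomodP M)) /F -pairing_counit.
  swelim (drho M m) => c m0; swpure.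
  transitivity (p d (i m0) *:
      bi (bi (bi (\sw_(c1, c2 <- hcop B c) hmul c1 (TB c2))))).
    by rewrite TB_r !linvZ !linv_one.
  by swext (hcop B c); swpure; rewrite lautoK -linv_mul.
rewrite /F; swelim (drho M m) => c m0; swpure; rewrite rhoE.
swext (drho M m0); swpure.
by rewrite lautoK (bilinZr _ _ _ bB) !linvZ.
Qed.

Definition evr : dhom (tensD M D) unitD.
Proof.
apply: (@Dhom _ _ _ _ _ (mklin evr_linear)).
- exact: evr_act.
- exact: evr_rho.
- move=> t; rewrite /= /tmap_fun /evr_fun; swext t; swpure.
  by rewrite muE lautoK.
Defined.

Local Notation w := (coevl e f : tensD D M).

Lemma coevl_act h : dact (tensD D M) h w = heps H h *: w.
Proof.
apply: (contractl_inj pB pD) => m.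
rewrite /= /tact.
transitivity
  (dact M (ai (\sw_(h1, h2 <- hcop H h) hmul h2 (TH h1))) (i m)).
  swelim (hcop H h) => h1 h2; swpure.
  rewrite linv_mul -(linv_anti _ aH) -[i m](linvK (dmu M)) -act_act.
  rewrite -(coevlK pB pM (dact M (TH (ai h1)) (i (i m)))).
  move: (coevl e f) => X; swext X; swpure.
  by rewrite actE (bilinZr _ _ _ bA).
rewrite TH_r linvZ linv_one (bilinZl _ _ _ bA) (h1act (dmodP M)) linvK.
have lc : linear (fun t : tens D M => \sw_(d, x <- t) (p d m *: x)) by swlin.
by rewrite -[RHS]/(mklin lc _) linearZ /= coevlK.
Qed.

Lemma coevl_rho : drho (tensD D M) w = hone B ⊗ w.
Proof.
apply: (contract2l_inj pB pD) => m.
transitivity (hone B ⊗ m); last first.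
  rewrite tlift_pure; last by swlin.
  rewrite -{1}(coevlK pB pM m); move: w => X; swext X; swpure.
  by rewrite (bilinZr _ _ _ (bt _ _)).
rewrite /= /trho_fun.
transitivity (\sw_(y, x <- w) \sw_(b, x0 <- drho M x)
    (bi (bi (hmul (contract p (drho D y) m) b)) ⊗ x0)).
  move: w => X; rewrite /contract; swelim X => y x; swpure.
  swelim (drho M x) => b x0; swext (drho D y); swpure.
  by rewrite (bilinZl _ _ _ bB) !linvZ (bilinZl _ _ _ (bt _ _)).
transitivity (\sw_(c, m0 <- drho M m) \sw_(b, x0 <- drho M (i (i m0)))
    (bi (bi (hmul (bi (TB c)) b)) ⊗ x0)).
  transitivity (\sw_(c, m0 <- drho M m)
    \sw_(b, x0 <- drho M (\sw_(y, x <- w) (p y (i (i m0)) *: x)))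
      (bi (bi (hmul (bi (TB c)) b)) ⊗ x0)).
    move: w => X; swelim X => y x; swpure.
    rewrite rhoE; swelim (drho M m) => c m0; swpure.
    rewrite linearZ /=; swext (drho M x); swpure.
    rewrite -[p y _ *: (_ ⊗ v)](bilinZl _ _ _ (bt _ _)); swpure.
    by rewrite (bilinZr _ _ _ bB) (bilinZl _ _ _ bB).
  by congr tlift; apply/funext => c; apply/funext => m0; rewrite coevlK.
(* The outer leg now stands on the left under [TB], which leads to TB(c_1) c_2. *)
pose F (X : tens B (tens B M)) : tens B M :=
  \sw_(a, r <- X) \sw_(b, x <- r)
    (bi (bi (hmul (bi (TB (bi a))) (bi (bi b)))) ⊗ i (i x)).
transitivity (F (\sw_(c, m0 <- drho M m) \sw_(c', m00 <- drho M m0)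
    (hal B c ⊗ (c' ⊗ m00)))).
  rewrite /F; swelim (drho M m) => c m0; swpure.
  rewrite !linv_rho; swext (drho M m0); swpure.
  by rewrite lautoK.
rewrite (hrhoA (dcomodP M)) /F.
transitivity (\sw_(c, m0 <- drho M m)
   (bi (bi (bi (bi (\sw_(c1, c2 <- hcop B c) hmul (TB c1) c2)))) ⊗ i m0)).
  swelim (drho M m) => c m0; swpure; swext (hcop B c); swpure.
  by rewrite lautoK (linv_anti _ aB) !linv_mul.
rewrite -{2}[m](lautoK (dmu M)) -(heps_rho (dcomodP M)).
swext (drho M m); swpure; rewrite TB_l !linvZ !linv_one.
by rewrite (bilinZl _ _ _ (bt _ _)) (bilinZr _ _ _ (bt _ _)).
Qed.

Lemma coevl_mu : dmu (tensD D M) w = w.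
Proof.
apply: (contractl_inj pB pD) => m.
transitivity (dmu M (\sw_(d, x <- w) (p d (i m) *: x))).
  rewrite /= /tmap_fun; move: w => X; swext X; swpure.
  by rewrite muE linearZ.
by rewrite !coevlK // linvK.
Qed.

Definition coevl_hom := invariant_hom coevl_act coevl_rho coevl_mu.

(** [M] and [D] exchange roles in [exact_pairing], so the first zig-zag is [coevlKd] and the second
    [coevlK]. *)
Lemma right_dualP : right_dual M D.
Proof.
exists evr, coevl_hom; split=> [d|m].
- have -> : tmap coevl_hom idfun (lunit_inv d) = w ⊗ linv (dmu D) d.
    rewrite tmapE /lunit_inv; swpure.
    by rewrite /= /invariant_fun scale1r.
  rewrite /assoc tlift_pure; last by swlin.
  rewrite /runit tmapE linvK -{2}(coevlKd pB pD d).
  move: w => X; swext X; swpure.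
  rewrite /= /evr_fun; swpure.
  by rewrite !linvK.
- have -> : tmap idfun coevl_hom (runit_inv m) = i m ⊗ w.
    rewrite tmapE /runit_inv; swpure.
    by rewrite /= /invariant_fun scale1r.
  rewrite /assoc_inv tlift_pure; last by swlin.
  rewrite /lunit tmapE linvK -{2}(coevlK pB pM m).
  move: w => X; swext X; swpure.
  rewrite /= /evr_fun; swpure.
  by rewrite !linvK.
Qed.

End RightDual.

End Duality.

(** * Assembly of both duals inside the finite-dimensional dimodules *)

Lemma dual_bases_fin_dim (k : fieldType) (H B : homHopf k) (M D : dimod H B)
    (p : D -> M -> k^o) n (e : 'I_n -> M) (f : 'I_n -> D) :
  (forall d, d = \sum_(i < n) p d (e i) *: f i) -> fin_dim D.
Proof. by move=> pD; exists n, f => d; exists (fun i => p d (e i)); apply: pD. Qed.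

Theorem theorem2p6 (k : fieldType) (H B : homHopf k)
    (bijSH : bijective (hantip H)) (bijSB : bijective (hantip B)) :
  autonomous (@fin_dim k H B).
Proof.
move=> M /dual_bases[D [p [n [e [f [pB pD pM]]]]]].
have [TH [aTH TH_l TH_r]] := antip_inv bijSH.
have [TB [aTB TB_l TB_r]] := antip_inv bijSB.
have aSH := antip_anti H; have aSB := antip_anti B.
have := hantip_l (hantipP H); have := hantip_r (hantipP H) => SH_r SH_l.
have := hantip_l (hantipP B); have := hantip_r (hantipP B) => SB_r SB_l.
split.
  (* Evaluation on D ⊗ M meets the legs of [H] in natural order and those of [B] in swapped order,
     hence [S] for [H] and its inverse for [B]; the right dual makes the opposite choice. *)
  pose N := dual pB pD pM aSH aTB; exists N.
    exact: (@dual_bases_fin_dim _ _ _ M N p n e f).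
  apply: (@left_dualP _ _ _ M N p n e f pB pD pM _ _ aSH aTB) => //.
  - exact: dual_muE.
  - exact: dual_actE.
  - exact: dual_rhoE.
pose N := dual pB pD pM aTH aSB; exists N.
  exact: (@dual_bases_fin_dim _ _ _ M N p n e f).
apply: (@right_dualP _ _ _ M N p n e f pB pD pM _ _ aTH aSB) => //.
- exact: dual_muE.
- exact: dual_actE.
- exact: dual_rhoE.
Qed.
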